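(* Let $M_1,M_2$ be monoids with a common submonoid $W$, let $L=M_1\ast_W M_2$ be the amalgamated free product, and suppose that $\mathbb ZL$ is flat as both a left and a right $\mathbb ZM_i$-module, for $i=1,2$, and as both a left and a right $\mathbb ZW$-module. Let $1\le n\le\infty$. If $M_1,M_2$ are of type bi-$\mathrm{FP}_n$ and $W$ is of type bi-$\mathrm{FP}_{n-1}$, then $M_1\ast_W M_2$ is of type bi-$\mathrm{FP}_n$.
   Context: Convention: $\infty-1=\infty$. $M_1\ast_W M_2$ is the pushout, in the category of monoids, of the inclusions $W\to M_1$ and $W\to M_2$; $\mathbb ZL$ is a left and right module over $\mathbb ZM_1$, $\mathbb ZM_2$, $\mathbb ZW$ via the canonical homomorphisms to $L$ (which need not be injective). A monoid $M$ is of type bi-$\mathrm{FP}_n$ ($0\le n\le\infty$) if the $(\mathbb ZM,\mathbb ZM)$-bimodule $\mathbb ZM$ has a resolution $\cdots\to P_1\to P_0\to\mathbb ZM\to 0$ by projective $(\mathbb ZM,\mathbb ZM)$-bimodules with $P_i$ finitely generated for all $i\le n$ (for all $i$ if $n=\infty$). *)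

(* Defs.v *)
From HB Require Import structures.
From mathcomp Require Import all_boot all_algebra.
From mathcomp Require Import finmap.
From mathcomp Require Import boolp.
From mathcomp.multinomials Require Import monalg.

Set Implicit Arguments.
Unset Strict Implicit.
Unset Printing Implicit Defensive.

Import GRing.Theory.

Local Open Scope ring_scope.

Reserved Notation "{ 'monoid' M -> N }"
  (at level 0, M at level 98, N at level 99, format "{ 'monoid'  M  ->  N }").
Reserved Notation "v *< b" (at level 40, left associativity).
Reserved Notation "{ 'bimod' U -> V }"
  (at level 0, U at level 98, V at level 99, format "{ 'bimod'  U  ->  V }").

Notation "{ 'monoid' M -> N }" := (UMagmaMorphism.type M N) : type_scope.

Definition is_pushout (W M1 M2 L : monoidType)
    (i1 : {monoid W -> M1}) (i2 : {monoid W -> M2})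
    (j1 : {monoid M1 -> L}) (j2 : {monoid M2 -> L}) : Prop :=
  (forall w, j1 (i1 w) = j2 (i2 w)) /\
  forall (N : monoidType) (f1 : {monoid M1 -> N}) (f2 : {monoid M2 -> N}),
    (forall w, f1 (i1 w) = f2 (i2 w)) ->
    exists h : {monoid L -> N},
      [/\ forall x, h (j1 x) = f1 x, forall y, h (j2 y) = f2 y &
       forall h' : {monoid L -> N}, (forall x, h' (j1 x) = f1 x) ->
         (forall y, h' (j2 y) = f2 y) -> forall z, h' z = h z].

(* [{malg K}] is the free abelian group on [K]; [zlift F] is the additive map  *)
(* extending [F] from the basis [K].                                          *)
Section FreeAbelianGroup.
Variable K : choiceType.

Definition zlift (A : zmodType) (F : K -> A) (g : {malg K}) : A :=
  \sum_(k <- msupp g) F k *~ g@_k.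

Lemma zliftEw (A : zmodType) (F : K -> A) (d : {fset K}) (g : {malg K}) :
  (msupp g `<=` d)%fset -> zlift F g = \sum_(k <- d) F k *~ g@_k.
Proof.
move=> le_gd; apply: big_fset_incl => // k _ /mcoeff_outdom ->.
by rewrite mulr0z.
Qed.

Lemma zlift_is_zmod_morphism (A : zmodType) (F : K -> A) :
  zmod_morphism (zlift F).
Proof.
move=> g1 g2; pose d := (msupp g1 `|` msupp g2)%fset.
rewrite (@zliftEw _ F d g1) ?fsubsetUl // (@zliftEw _ F d g2) ?fsubsetUr //.
rewrite (@zliftEw _ F d (g1 - g2)) ?msuppB_le // -sumrB.
by apply: eq_bigr => k _; rewrite mcoeffB mulrzBr.
Qed.

HB.instance Definition _ (A : zmodType) (F : K -> A) :=
  GRing.isZmodMorphism.Build {malg K} A (zlift F) (zlift_is_zmod_morphism F).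

Lemma zliftB (A : zmodType) (F : K -> A) g h :
  zlift F (g - h) = zlift F g - zlift F h.
Proof. exact: (raddfB (zlift F)). Qed.

Lemma zliftU (A : zmodType) (F : K -> A) k : zlift F << k >> = F k.
Proof. by rewrite /zlift msuppU oner_eq0 big_seq_fset1 mcoeffUU. Qed.

Lemma malg_ind (P : {malg K} -> Prop) :
  P 0 -> (forall k, P << k >>) -> (forall g h, P g -> P h -> P (g - h)) ->
  forall g, P g.
Proof.
move=> P0 PU PB.
have PN g : P g -> P (- g) by move=> Pg; rewrite -sub0r; apply: PB.
have PD g h : P g -> P h -> P (g + h).
  by move=> Pg Ph; rewrite -[h]opprK; apply: PB => //; apply: PN.
have PM g n : P g -> P (g *+ n).
  by move=> Pg; elim: n => [|n IHn]; rewrite ?mulr0n // mulrS; apply: PD.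
move=> g; rewrite [g]monalgE; apply: (big_ind P) => // k _.
have -> : << g@_k *g k >> = << k >> *~ g@_k :> {malg K}.
  by rewrite -[in LHS](intz g@_k) raddfMz.
by case: (g@_k) => n; [apply: PM | apply: PN; apply: PM].
Qed.

End FreeAbelianGroup.

(* [Z M], on an alias of [{malg M}] because [monalg] only makes [{malg M}] a   *)
(* ring when [M] has no invertible element but 1.                             *)
Definition monoid_ring (M : monoidType) : Type := {malg M}.

Definition mr_of (M : monoidType) (x : M) : monoid_ring M := << x >>.

Section MonoidRing.
Variable M : monoidType.

HB.instance Definition _ := GRing.Zmodule.on (monoid_ring M).

Implicit Types g h : monoid_ring M.

Lemma mr_ind (P : monoid_ring M -> Prop) :
  P 0 -> (forall x, P (mr_of x)) -> (forall g h, P g -> P h -> P (g - h)) ->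
  forall g, P g.
Proof. exact: malg_ind. Qed.

Definition mr_mul g h : monoid_ring M :=
  zlift (fun x : M => zlift (fun y : M => mr_of (x * y)%g) h) g.

Fact mr_mulUU (x y : M) : mr_mul (mr_of x) (mr_of y) = mr_of (x * y)%g.
Proof. by rewrite /mr_mul !zliftU. Qed.

Fact mr_mulBl g1 g2 h : mr_mul (g1 - g2) h = mr_mul g1 h - mr_mul g2 h.
Proof. exact: (raddfB (zlift _)). Qed.

Fact mr_mulBr g h1 h2 : mr_mul g (h1 - h2) = mr_mul g h1 - mr_mul g h2.
Proof.
rewrite /mr_mul [LHS]/zlift [X in _ = X - _]/zlift [X in _ = _ - X]/zlift.
rewrite -sumrB; apply: eq_bigr => x _; rewrite -mulrzBl; congr (_ *~ _).
exact: (raddfB (zlift _)).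
Qed.

Fact mr_mul0l h : mr_mul 0 h = 0.
Proof. exact: (raddf0 (zlift _)). Qed.

Fact mr_mul0r g : mr_mul g 0 = 0.
Proof. by have := mr_mulBr g 0 0; rewrite !subrr. Qed.

Fact mr_mulDl : left_distributive mr_mul +%R.
Proof. by move=> g1 g2 h; exact: (raddfD (zlift _)). Qed.

Fact mr_mulDr : right_distributive mr_mul +%R.
Proof.
move=> g h1 h2; have := mr_mulBr g (h1 + h2) h2.
by rewrite addrK => ->; rewrite subrK.
Qed.

Fact mr_mulA : associative mr_mul.
Proof.
move=> g1 g2 g3; elim/mr_ind: g1 => [|x|g h Eg Eh]; last 1 first.
- by rewrite !mr_mulBl Eg Eh.
- by rewrite !mr_mul0l.
elim/mr_ind: g2 => [|y|g h Eg Eh]; last 1 first.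
- by rewrite mr_mulBl !mr_mulBr mr_mulBl Eg Eh.
- by rewrite mr_mul0r !mr_mul0l mr_mul0r.
elim/mr_ind: g3 => [|z|g h Eg Eh]; last 1 first.
- by rewrite !mr_mulBr Eg Eh.
- by rewrite !mr_mul0r.
by rewrite !mr_mulUU mulgA.
Qed.

Fact mr_mul1l : left_id (mr_of 1%g) mr_mul.
Proof.
elim/mr_ind => [|x|g h Eg Eh]; first exact: mr_mul0r.
  by rewrite mr_mulUU mul1g.
by rewrite mr_mulBr Eg Eh.
Qed.

Fact mr_mul1r : right_id (mr_of 1%g) mr_mul.
Proof.
elim/mr_ind => [|x|g h Eg Eh]; first exact: mr_mul0l.
  by rewrite mr_mulUU mulg1.
by rewrite mr_mulBl Eg Eh.
Qed.

Fact mr_one_neq0 : mr_of (1%g : M) != 0.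
Proof. by rewrite monalgU_eq0 oner_eq0. Qed.

HB.instance Definition _ := GRing.Zmodule_isNzRing.Build (monoid_ring M)
  mr_mulA mr_mul1l mr_mul1r mr_mulDl mr_mulDr mr_one_neq0.

Lemma mr_ofM (x y : M) : mr_of (x * y)%g = mr_of x * mr_of y.
Proof. exact/esym/mr_mulUU. Qed.

End MonoidRing.

Section MonoidRingMap.
Variables (M N : monoidType) (f : {monoid M -> N}).

Definition monoid_ring_map : monoid_ring M -> monoid_ring N :=
  zlift (fun x => mr_of (f x)).

Fact monoid_ring_map_is_zmod_morphism : zmod_morphism monoid_ring_map.
Proof. exact: (raddfB (zlift _)). Qed.

HB.instance Definition _ := GRing.isZmodMorphism.Build
  (monoid_ring M) (monoid_ring N) monoid_ring_map
  monoid_ring_map_is_zmod_morphism.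

Lemma monoid_ring_mapU x : monoid_ring_map (mr_of x) = mr_of (f x).
Proof. exact: zliftU. Qed.

Fact monoid_ring_map_is_monoid_morphism : monoid_morphism monoid_ring_map.
Proof.
split=> [|g h]; first by rewrite [LHS]monoid_ring_mapU gmulf1.
elim/mr_ind: g => [|x|g1 g2 E1 E2].
- by rewrite mul0r raddf0 mul0r.
- elim/mr_ind: h => [|y|h1 h2 E1 E2].
  + by rewrite mulr0 raddf0 mulr0.
  + by rewrite -mr_ofM !monoid_ring_mapU -mr_ofM gmulfM.
  + by rewrite mulrBr !raddfB /= mulrBr E1 E2.
- by rewrite mulrBl !raddfB /= mulrBl E1 E2.
Qed.

HB.instance Definition _ := GRing.isMonoidMorphism.Build
  (monoid_ring M) (monoid_ring N) monoid_ring_map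
  monoid_ring_map_is_monoid_morphism.

End MonoidRingMap.

Definition pair_choice (K1 K2 : choiceType) : choiceType := (K1 * K2)%type.

(* Right [R]-modules are left modules over the converse ring [R^c]: for        *)
(* [A : lmodType R^c], [a *: x] with [a : R^c] is the right action of [a] on   *)
(* [x].                                                                       *)
Section Tensor.
Variables (R : pzRingType) (A : lmodType R^c) (B : lmodType R).
Local Notation AB := (pair_choice A B).

Definition balanced (G : zmodType) (b : A -> B -> G) : Prop :=
  [/\ forall x1 x2 y, b (x1 + x2) y = b x1 y + b x2 y,
      forall x y1 y2, b x (y1 + y2) = b x y1 + b x y2 &
      forall (a : R) x y, b ((a : R^c) *: x) y = b x (a *: y)].

Definition tensor_gen (x : A) (y : B) : {malg AB} := << ((x, y) : AB) >>.

Definition tensor_relator (u : {malg AB}) : Prop :=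
  [\/ exists x1 x2 y, u = tensor_gen (x1 + x2) y - tensor_gen x1 y - tensor_gen x2 y,
      exists x y1 y2, u = tensor_gen x (y1 + y2) - tensor_gen x y1 - tensor_gen x y2 |
      exists (a : R) x y, u = tensor_gen ((a : R^c) *: x) y - tensor_gen x (a *: y)].

(* The subgroup generated by the relators. *)
Definition tensor_ker : {pred {malg AB}} := fun u =>
  `[< forall S : {pred {malg AB}}, zmod_closed S ->
        (forall v, tensor_relator v -> v \in S) -> u \in S >].

Fact tensor_ker_zmod_closed : zmod_closed tensor_ker.
Proof.
split=> [|u v /asboolP Ku /asboolP Kv].
  by apply/asboolP => S [].
by apply/asboolP => S cS relS; apply: cS.2; [apply: Ku | apply: Kv].
Qed.

HB.instance Definition _ := GRing.isZmodClosed.Build {malg AB}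
  tensor_ker tensor_ker_zmod_closed.

Definition tensor : Type := Quotient.quot tensor_ker.

HB.instance Definition _ := Choice.on tensor.
HB.instance Definition _ := GRing.Zmodule.on tensor.

Definition tensor_pi (u : {malg AB}) : tensor :=
  \pi_(Quotient.quot tensor_ker)%qT u.

Definition pure (x : A) (y : B) : tensor := tensor_pi (tensor_gen x y).

Fact tensor_pi_is_zmod_morphism : zmod_morphism tensor_pi.
Proof. exact: pi_is_zmod_morphism. Qed.

HB.instance Definition _ := GRing.isZmodMorphism.Build
  {malg AB} tensor tensor_pi tensor_pi_is_zmod_morphism.

Lemma tensor_pi_eq u v : tensor_pi u = tensor_pi v <-> u - v \in tensor_ker.
Proof.
rewrite (Quotient.idealrBE tensor_ker).
by split=> [E|/eqP//]; apply/eqP.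
Qed.

Lemma tensor_relator0 u : tensor_relator u -> tensor_pi u = 0.
Proof.
move=> ru; rewrite -(raddf0 tensor_pi); apply/tensor_pi_eq; rewrite subr0.
by apply/asboolP => S _; apply.
Qed.

Lemma pure_balanced : balanced pure.
Proof.
split=> [x1 x2 y|x y1 y2|a x y]; apply/eqP; rewrite -subr_eq0.
- rewrite opprD addrA -!raddfB; apply/eqP/tensor_relator0.
  by constructor 1; exists x1, x2, y.
- rewrite opprD addrA -!raddfB; apply/eqP/tensor_relator0.
  by constructor 2; exists x, y1, y2.
- by rewrite -raddfB; apply/eqP/tensor_relator0; constructor 3; exists a, x, y.
Qed.

Lemma tensor_ind (P : tensor -> Prop) :
  P 0 -> (forall x y, P (pure x y)) -> (forall u v, P u -> P v -> P (u - v)) ->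
  forall u, P u.
Proof.
move=> P0 PU PB u; rewrite -[u](@reprK _ (Quotient.quot tensor_ker)).
change (P (tensor_pi (repr u))).
elim/malg_ind: (repr u) => [|[x y]|g h Pg Ph].
- by rewrite raddf0.
- exact: PU.
- by rewrite raddfB; apply: PB.
Qed.

Definition tensor_lift (G : zmodType) (b : A -> B -> G) (u : tensor) : G :=
  zlift (fun xy : AB => b xy.1 xy.2) (repr (u : Quotient.quot tensor_ker)).

Section Lift.
Variables (G : zmodType) (b : A -> B -> G).
Hypothesis b_balanced : balanced b.

Lemma tensor_lift_pi u : tensor_lift b (tensor_pi u) =
  zlift (fun xy : AB => b xy.1 xy.2) u.
Proof.
apply/eqP; rewrite -subr_eq0 -raddfB; set v := _ - u.
have /asboolP Kv : v \in tensor_ker.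
  by apply/tensor_pi_eq; exact: (@reprK _ (Quotient.quot tensor_ker)).
pose S : {pred {malg AB}} :=
  fun w => zlift (fun xy : AB => b xy.1 xy.2) w == 0.
apply: (Kv S) => [|w].
  split=> [|w1 w2 /eqP Sw1 /eqP Sw2]; apply/eqP; first exact: raddf0.
  by rewrite zliftB Sw1 Sw2 subr0.
case: b_balanced => bDl bDr bZ; case=> [[x1 [x2 [y ->]]]|[x [y1 [y2 ->]]]|].
- by apply/eqP; rewrite !zliftB !zliftU /= bDl -addrA -opprD subrr.
- by apply/eqP; rewrite !zliftB !zliftU /= bDr -addrA -opprD subrr.
- by case=> a [x [y ->]]; apply/eqP; rewrite zliftB !zliftU /= bZ subrr.
Qed.

Lemma tensor_lift_pure x y : tensor_lift b (pure x y) = b x y.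
Proof. by rewrite tensor_lift_pi zliftU. Qed.

Lemma tensor_lift_zmod_morphism : zmod_morphism (tensor_lift b).
Proof.
move=> u v; rewrite -[u](@reprK _ (Quotient.quot tensor_ker)).
rewrite -[v](@reprK _ (Quotient.quot tensor_ker)).
change (tensor_lift b (tensor_pi (repr u) - tensor_pi (repr v)) =
  tensor_lift b (tensor_pi (repr u)) - tensor_lift b (tensor_pi (repr v))).
by rewrite -raddfB !tensor_lift_pi raddfB.
Qed.

End Lift.
End Tensor.

Arguments pure {R A B} x y.

Section TensorMap.
Variables (R : pzRingType) (A A' : lmodType R^c) (B B' : lmodType R).

Definition tensor_map (f : {linear A -> A'}) (g : {linear B -> B'}) :
    tensor A B -> tensor A' B' :=
  tensor_lift (fun x y => pure (f x) (g y)).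

Section Theory.
Variables (f : {linear A -> A'}) (g : {linear B -> B'}).

Fact tensor_map_balanced : balanced (fun x y => pure (f x) (g y)).
Proof.
have [pDl pDr pZ] := pure_balanced A' B'.
by split=> *; rewrite ?linearD ?linearZ ?pDl ?pDr ?pZ.
Qed.

Lemma tensor_map_pure x y : tensor_map f g (pure x y) = pure (f x) (g y).
Proof. exact: tensor_lift_pure tensor_map_balanced _ _. Qed.

Fact tensor_map_is_zmod_morphism : zmod_morphism (tensor_map f g).
Proof. exact: tensor_lift_zmod_morphism tensor_map_balanced. Qed.

HB.instance Definition _ := GRing.isZmodMorphism.Build
  (tensor A B) (tensor A' B') (tensor_map f g) tensor_map_is_zmod_morphism.

End Theory.
End TensorMap.

Definition left_flat (R : pzRingType) (F : lmodType R) : Prop :=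
  forall (A A' : lmodType R^c) (f : {linear A -> A'}),
    injective f -> injective (tensor_map f (idfun : {linear F -> F})).

Definition right_flat (R : pzRingType) (F : lmodType R^c) : Prop :=
  forall (B B' : lmodType R) (g : {linear B -> B'}),
    injective g -> injective (tensor_map (idfun : {linear F -> F}) g).

(* [S] as a left, resp. right, [R]-module by restriction of scalars along a    *)
(* ring morphism [phi], which need not be injective.                          *)
Definition left_restr (R S : pzRingType) (phi : {rmorphism R -> S}) : Type := S.
Definition right_restr (R S : pzRingType) (phi : {rmorphism R -> S}) : Type := S.

Section Restriction.
Variables (R S : pzRingType) (phi : {rmorphism R -> S}).
Local Notation left_restr := (left_restr phi).
Local Notation right_restr := (right_restr phi).

HB.instance Definition _ := GRing.Zmodule.on left_restr.
HB.instance Definition _ := GRing.Zmodule.on right_restr.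

Definition left_restr_scale (a : R) (x : left_restr) : left_restr :=
  (phi a * x : S).
Definition right_restr_scale (a : R^c) (x : right_restr) : right_restr :=
  ((x : S) * phi a : S).

Fact left_restr_scaleA a b x :
  left_restr_scale a (left_restr_scale b x) = left_restr_scale (a * b) x.
Proof. by rewrite /left_restr_scale rmorphM mulrA. Qed.

Fact left_restr_scale1 : left_id 1 left_restr_scale.
Proof. by move=> x; rewrite /left_restr_scale rmorph1 mul1r. Qed.

Fact left_restr_scaleDr : right_distributive left_restr_scale +%R.
Proof. by move=> a x y; exact: mulrDr. Qed.

Fact left_restr_scaleDl x : {morph left_restr_scale^~ x : a b / a + b}.
Proof. by move=> a b; rewrite /left_restr_scale rmorphD mulrDl. Qed.

HB.instance Definition _ := GRing.Zmodule_isLmodule.Build R left_restr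
  left_restr_scaleA left_restr_scale1 left_restr_scaleDr left_restr_scaleDl.

Fact right_restr_scaleA a b x :
  right_restr_scale a (right_restr_scale b x) = right_restr_scale (a * b) x.
Proof.
rewrite /right_restr_scale (_ : a * b = (b : R) * (a : R)) //.
by rewrite rmorphM mulrA.
Qed.

Fact right_restr_scale1 : left_id 1 right_restr_scale.
Proof. by move=> x; rewrite /right_restr_scale rmorph1 mulr1. Qed.

Fact right_restr_scaleDr : right_distributive right_restr_scale +%R.
Proof. by move=> a x y; exact: mulrDl. Qed.

Fact right_restr_scaleDl x : {morph right_restr_scale^~ x : a b / a + b}.
Proof. by move=> a b; rewrite /right_restr_scale rmorphD mulrDr. Qed.

HB.instance Definition _ := GRing.Zmodule_isLmodule.Build R^c right_restr
  right_restr_scaleA right_restr_scale1 right_restr_scaleDr right_restr_scaleDl.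

End Restriction.

(* [Z L] is flat as a left and as a right [Z M]-module via [f].                *)
Definition flat_along (M L : monoidType) (f : {monoid M -> L}) : Prop :=
  left_flat (left_restr (monoid_ring_map f)) /\
  right_flat (right_restr (monoid_ring_map f)).

HB.mixin Record Lmodule_isBimodule (R S : pzRingType) V of GRing.Lmodule R V := {
  rscale : V -> S -> V;
  rscalerA : forall v a b, rscale (rscale v a) b = rscale v (a * b);
  rscaler1 : forall v, rscale v 1 = v;
  rscalerDl : forall b, {morph rscale^~ b : u v / u + v};
  rscalerDr : forall v, {morph rscale v : a b / a + b};
  scaler_rscaler : forall (a : R) v b, a *: rscale v b = rscale (a *: v) b
}.

#[short(type="bimodType")]
HB.structure Definition Bimodule (R S : pzRingType) :=
  {V of Lmodule_isBimodule R S V & GRing.Lmodule R V}.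

Notation "v *< b" := (rscale v b) : ring_scope.

(* [R] as an [(R, R)]-bimodule, on the library's regular left module [R^o].    *)
Section RegularBimodule.
Variable R : pzRingType.

Definition regular_rscale (v : R^o) (b : R) : R^o := (v : R) * b.

Fact regular_rscalerA v a b :
  regular_rscale (regular_rscale v a) b = regular_rscale v (a * b).
Proof. exact/esym/mulrA. Qed.

Fact regular_rscaler1 v : regular_rscale v 1 = v.
Proof. exact: mulr1. Qed.

Fact regular_rscalerDl b : {morph regular_rscale^~ b : u v / u + v}.
Proof. by move=> u v; exact: mulrDl. Qed.

Fact regular_rscalerDr v : {morph regular_rscale v : a b / a + b}.
Proof. by move=> a b; exact: mulrDr. Qed.

Fact regular_scaler_rscaler (a : R) v b :
  a *: regular_rscale v b = regular_rscale (a *: v) b.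
Proof. exact: mulrA. Qed.

HB.instance Definition _ := Lmodule_isBimodule.Build R R R^o
  regular_rscalerA regular_rscaler1 regular_rscalerDl regular_rscalerDr
  regular_scaler_rscaler.

End RegularBimodule.

HB.mixin Record isRightScalable (R S : pzRingType) (U V : bimodType R S)
    (f : U -> V) := {
  rscalable_subproof : forall u b, f (u *< b) = f u *< b
}.

HB.structure Definition BimodMorphism (R S : pzRingType) (U V : bimodType R S) :=
  {f of isRightScalable R S U V f & @GRing.Linear R U V *:%R f}.

Notation "{ 'bimod' U -> V }" := (BimodMorphism.type U V) : type_scope.

Section BimoduleProperties.
Variables (R S : pzRingType) (P : bimodType R S).

Definition projective : Prop :=
  forall (U V : bimodType R S) (g : {bimod U -> V}) (f : {bimod P -> V}),
    (forall v, exists u, g u = v) ->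
    exists h : {bimod P -> U}, forall x, g (h x) = f x.

Definition finitely_generated : Prop :=
  exists X : seq P, forall v, exists t : seq (R * P * S),
    {subset [seq u.1.2 | u <- t] <= X} /\
    v = \sum_(u <- t) u.1.1 *: u.1.2 *< u.2.

End BimoduleProperties.

Record projective_resolution (R S : pzRingType) (V : bimodType R S) := {
  res_term :> nat -> bimodType R S;
  res_diff : forall i, {bimod res_term i.+1 -> res_term i};
  res_aug : {bimod res_term 0 -> V};
  res_projective : forall i, projective (res_term i);
  res_aug_surj : forall v, exists x, res_aug x = v;
  res_exact0 : forall x, res_aug x = 0 <-> exists y, res_diff 0 y = x;
  res_exact : forall i x, res_diff i x = 0 <-> exists y, res_diff i.+1 y = x
}.

(* Values in [{0, 1, 2, ...} + {oo}]: [None] is infinity. *)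
Definition enat := option nat.
Definition le_enat (i : nat) (n : enat) : bool :=
  if n is Some m then (i <= m)%N else true.
Definition pred_enat (n : enat) : enat := omap predn n.

Definition bi_FP (n : enat) (M : monoidType) : Prop :=
  exists P : projective_resolution (monoid_ring M)^o,
    forall i, le_enat i n -> finitely_generated (P i).

(* Main.v *)
(* Write [S = Z L], [R1 = Z M1], [R2 = Z M2] and [R0 = Z W]. The bimodules    *)
(* [E_i = S (x)_(R_i) S] fit into a sequence                                  *)
(*   0 -> E_0 -> E_1 (+) E_2 -> S -> 0,                                       *)
(* which is exact for any pushout of monoids. Indeed, writing [e_i] for the   *)
(* pure tensor of [1] and [1] in [E_i], the pushout property applied to the   *)
(* monoid of pairs [(l, a)] in [L x E_0] provides derivations                 *)
(* [D_1, D_2 : S -> E_0] such that [D_1] vanishes on [M2] and is              *)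
(* [x |-> e_0 x - x e_0] on [M1], and symmetrically for [D_2]. Then           *)
(* [s e_2 t |-> s D_1(t)] and [s e_1 t |-> s D_2(t)] are well defined         *)
(* additive maps [p : E_2 -> E_0] and [q : E_1 -> E_0], and they split the    *)
(* sequence: with [b_i : E_0 -> E_i] and [m : E_0 -> S] the canonical maps,   *)
(* [p b_2 z + q b_1 z = z - m(z) e_0], [b_1 p = 0] and [b_2 q = 0].           *)
(* By flatness, [S (x)_(R_i) - (x)_(R_i) S] turns projective resolutions of   *)
(* [R_i] into projective resolutions of [E_i]. The mapping cone of a lift of  *)
(* [E_0 -> E_1 (+) E_2] to these is a resolution of [S], with the degree      *)
(* shift that accounts for the weaker assumption on [W].                      *)
From HB Require Import structures.
Require Import Defs.
From mathcomp Require Import all_boot all_algebra.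
From mathcomp Require Import boolp.

Set Implicit Arguments.
Unset Strict Implicit.
Unset Printing Implicit Defensive.

Import GRing.Theory.

Local Open Scope ring_scope.

(** * Bimodules *)

(** The regular bimodule of [monoid_ring L] is the cokernel of an injection between bimodules
    induced from the three smaller monoid rings, so a resolution of it can be assembled from induced
    resolutions.

    The pushout enters through derivations. A derivation on [L] is a homomorphism to the semidirect
    product [crossed] lying over the identity, so [pushout_derivation] and [derivation_ext] give
    existence and uniqueness of derivations with prescribed compatible values on [M1] and [M2].
    [pushout_sequence] turns two such derivations into explicit maps from which exactness is read
    off, with no normal form for the elements of [L].

    Flatness enters through [base_change_map_exact]: tensoring a resolution with S on both sides
    keeps it exact. Projectivity ([bc_projective]) and finite generation ([bc_fg]) survive any base
    change. In [cone_resolution] the resolution coming from [W] sits one degree higher than the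
    other two, so degree k+1 of the result uses only degree k of it; this is why n-1 suffices for
    [W]. *)

Section BimoduleTheory.
Variables R S : pzRingType.

Section Operations.
Variable V : bimodType R S.

Definition rscaleBy (b : S) (v : V) : V := v *< b.

Fact rscaleBy_is_zmod_morphism b : zmod_morphism (rscaleBy b).
Proof.
move=> u v; apply/(addIr (rscaleBy b v)).
by rewrite -[LHS]rscalerDl !subrK.
Qed.

HB.instance Definition _ b :=
  GRing.isZmodMorphism.Build V V (rscaleBy b) (rscaleBy_is_zmod_morphism b).

Fact rscaleBy_is_scalable b : scalable (rscaleBy b).
Proof. by move=> a v; apply/esym/scaler_rscaler. Qed.

HB.instance Definition _ b :=
  GRing.isScalable.Build R V V *:%R (rscaleBy b) (rscaleBy_is_scalable b).

Lemma rscale0r b : 0 *< b = 0 :> V.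
Proof. exact: (raddf0 (rscaleBy b)). Qed.

Lemma rscaleNr (v : V) b : (- v) *< b = - (v *< b).
Proof. exact: (raddfN (rscaleBy b)). Qed.

Lemma rscaleBr (u v : V) b : (u - v) *< b = u *< b - v *< b.
Proof. exact: (raddfB (rscaleBy b)). Qed.

Lemma rscaler_sum I (r : seq I) (F : I -> V) b :
  (\sum_(i <- r) F i) *< b = \sum_(i <- r) F i *< b.
Proof. exact: (raddf_sum (rscaleBy b)). Qed.

Definition rscaleAt (v : V) (b : S) : V := v *< b.

Fact rscaleAt_is_zmod_morphism v : zmod_morphism (rscaleAt v).
Proof.
move=> a b; apply/(addIr (rscaleAt v b)).
by rewrite -[LHS]rscalerDr !subrK.
Qed.

HB.instance Definition _ v :=
  GRing.isZmodMorphism.Build S V (rscaleAt v) (rscaleAt_is_zmod_morphism v).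

Lemma rscaler0 (v : V) : v *< 0 = 0.
Proof. exact: (raddf0 (rscaleAt v)). Qed.

Lemma rscalerB (v : V) a b : v *< (a - b) = v *< a - v *< b.
Proof. exact: (raddfB (rscaleAt v)). Qed.

End Operations.

Lemma rscalable (U V : bimodType R S) (f : {bimod U -> V}) u b :
  f (u *< b) = f u *< b.
Proof. exact: rscalable_subproof. Qed.

HB.instance Definition _ (U : bimodType R S) :=
  isRightScalable.Build R S U U idfun (fun _ _ => erefl).

Section MakeMorphism.
Variables (U V : bimodType R S) (f : U -> V).
Hypotheses (fB : zmod_morphism f) (fZ : scalable f)
  (fr : forall u b, f (u *< b) = f u *< b).

(** The proofs are arguments of the function so that the structure instances below can be attached
    to it; this gives a uniform way to package local functions as morphisms. *)
Definition bimod_fun of zmod_morphism f & scalable f &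
  (forall u b, f (u *< b) = f u *< b) := f.

HB.instance Definition _ :=
  GRing.isZmodMorphism.Build U V (bimod_fun fB fZ fr) fB.
HB.instance Definition _ :=
  GRing.isScalable.Build R U V *:%R (bimod_fun fB fZ fr) fZ.
HB.instance Definition _ :=
  isRightScalable.Build R S U V (bimod_fun fB fZ fr) fr.

Definition bimod_mor : {bimod U -> V} := bimod_fun fB fZ fr.

Lemma bimod_morE u : bimod_mor u = f u.
Proof. by []. Qed.

End MakeMorphism.

Section Span.
Variables (V : bimodType R S) (X : seq V).

(** Convertible to the condition inside [finitely_generated], so that generation can be proved from
    closure properties instead of explicit lists of triples. *)
Definition in_span (v : V) : Prop := exists t : seq (R * V * S),
  {subset [seq u.1.2 | u <- t] <= X} /\
  v = \sum_(u <- t) u.1.1 *: u.1.2 *< u.2.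

Lemma in_span0 : in_span 0.
Proof. by exists [::]; rewrite big_nil. Qed.

Lemma in_span_mem x : x \in X -> in_span x.
Proof.
move=> Xx; exists [:: (1, x, 1)]; split=> [y|]; first by rewrite inE => /eqP->.
by rewrite big_seq1 /= rscaler1 scale1r.
Qed.

Lemma in_spanD u v : in_span u -> in_span v -> in_span (u + v).
Proof.
move=> [s [sX ->]] [t [tX ->]]; exists (s ++ t); rewrite big_cat; split=> // y.
by rewrite map_cat mem_cat => /orP[/sX|/tX].
Qed.

Lemma in_spanZ a v : in_span v -> in_span (a *: v).
Proof.
move=> [t [tX ->]]; exists [seq (a * u.1.1, u.1.2, u.2) | u <- t].
rewrite -map_comp; split=> //; rewrite big_map scaler_sumr.
by apply: eq_bigr => u _ /=; rewrite scaler_rscaler scalerA.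
Qed.

Lemma in_span_rscale v b : in_span v -> in_span (v *< b).
Proof.
move=> [t [tX ->]]; exists [seq (u.1.1, u.1.2, u.2 * b) | u <- t].
rewrite -map_comp; split=> //; rewrite big_map rscaler_sum.
by apply: eq_bigr => u _ /=; rewrite rscalerA.
Qed.

Lemma in_spanB u v : in_span u -> in_span v -> in_span (u - v).
Proof. by move=> su sv; rewrite -scaleN1r; apply/in_spanD/in_spanZ. Qed.

End Span.

Section Product.
Variables U V : bimodType R S.

Definition prod_rscale (w : U * V) (b : S) : U * V := (w.1 *< b, w.2 *< b).

Fact prod_rscalerA w a b :
  prod_rscale (prod_rscale w a) b = prod_rscale w (a * b).
Proof. by rewrite /prod_rscale !rscalerA. Qed.

Fact prod_rscaler1 w : prod_rscale w 1 = w.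
Proof. by case: w => u v; rewrite /prod_rscale !rscaler1. Qed.

Fact prod_rscalerDl b : {morph prod_rscale^~ b : u v / u + v}.
Proof. by move=> u v; rewrite /prod_rscale !rscalerDl. Qed.

Fact prod_rscalerDr w : {morph prod_rscale w : a b / a + b}.
Proof. by move=> a b; rewrite /prod_rscale !rscalerDr. Qed.

Fact prod_scaler_rscaler (a : R) w b :
  a *: prod_rscale w b = prod_rscale (a *: w) b.
Proof. by congr pair; apply: scaler_rscaler. Qed.

HB.instance Definition _ := Lmodule_isBimodule.Build R S (U * V)%type
  prod_rscalerA prod_rscaler1 prod_rscalerDl prod_rscalerDr
  prod_scaler_rscaler.

End Product.

Lemma bimod_pair (A B C : bimodType R S) (f : {bimod A -> B})
  (g : {bimod A -> C}) : exists h : {bimod A -> (B * C)%type},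
  forall a, h a = (f a, g a).
Proof.
have hB : zmod_morphism (fun a => (f a, g a)) by move=> a b; rewrite !linearB.
have hZ : scalable (fun a => (f a, g a)) by move=> a b; rewrite !linearZ.
have hr u b : (fun a => (f a, g a)) (u *< b) = (f u, g u) *< b.
  by rewrite !rscalable.
by exists (bimod_mor hB hZ hr).
Qed.

Lemma bimod_copair (A B C : bimodType R S) (f : {bimod A -> C})
  (g : {bimod B -> C}) : exists h : {bimod (A * B)%type -> C},
  forall w, h w = f w.1 + g w.2.
Proof.
pose k (w : A * B) := f w.1 + g w.2.
have hB : zmod_morphism k.
  by move=> a b; rewrite /k !linearB /= opprD addrACA.
have hZ : scalable k by move=> a b; rewrite /k !linearZ /= scalerDr.
have hr u b : k (u *< b) = k u *< b by rewrite /k !rscalable rscalerDl.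
by exists (bimod_mor hB hZ hr).
Qed.

Lemma bimod_comp (A B C : bimodType R S) (g : {bimod B -> C})
  (f : {bimod A -> B}) : exists h : {bimod A -> C}, forall a, h a = g (f a).
Proof.
have hB : zmod_morphism (fun a => g (f a)) by move=> a b; rewrite !linearB.
have hZ : scalable (fun a => g (f a)) by move=> a b; rewrite !linearZ.
have hr u b : g (f (u *< b)) = g (f u) *< b by rewrite !rscalable.
by exists (bimod_mor hB hZ hr).
Qed.

Lemma bimod_opp (A B : bimodType R S) (f : {bimod A -> B}) :
  exists h : {bimod A -> B}, forall a, h a = - f a.
Proof.
have hB : zmod_morphism (fun a => - f a) 
  by move=> a b; rewrite linearB opprB addrC opprK.
have hZ : scalable (fun a => - f a) by move=> a b; rewrite linearZ scalerN.
have hr u b : - f (u *< b) = (- f u) *< b by rewrite rscalable rscaleNr.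
by exists (bimod_mor hB hZ hr).
Qed.

Lemma bimod_inl (A B : bimodType R S) :
  exists h : {bimod A -> (A * B)%type}, forall a, h a = (a, 0).
Proof.
have hB : zmod_morphism (fun a : A => (a, 0 : B)).
  by move=> a b; congr pair; rewrite subr0.
have hZ : scalable (fun a : A => (a, 0 : B)).
  by move=> a b; congr pair; rewrite scaler0.
have hr u b : (u *< b, 0) = (u : A, 0 : B) *< b by congr pair; rewrite rscale0r.
by exists (bimod_mor hB hZ hr).
Qed.

Lemma bimod_inr (A B : bimodType R S) :
  exists h : {bimod B -> (A * B)%type}, forall b, h b = (0, b).
Proof.
have hB : zmod_morphism (fun b : B => (0 : A, b)).
  by move=> a b; congr pair; rewrite subr0.
have hZ : scalable (fun b : B => (0 : A, b)).
  by move=> a b; congr pair; rewrite scaler0.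
have hr u b : (0, u *< b) = (0 : A, u : B) *< b by congr pair; rewrite rscale0r.
by exists (bimod_mor hB hZ hr).
Qed.

(** A map out of a direct sum is lifted on each summand separately, and the lifts are added. *)
Lemma projective_prod (A B : bimodType R S) :
  projective A -> projective B -> projective (A * B)%type.
Proof.
move=> pA pB U V g f sg.
have [iA iAE] := bimod_inl A B; have [iB iBE] := bimod_inr A B.
have [fA fAE] := bimod_comp f iA; have [fB fBE] := bimod_comp f iB.
have [hA hAE] := pA _ _ g fA sg; have [hB hBE] := pB _ _ g fB sg.
have [h hE] := bimod_copair hA hB; exists h => -[a b].
rewrite hE linearD /= hAE hBE fAE fBE -linearD /= iAE iBE.
by congr (f (_, _)); rewrite ?addr0 ?add0r.
Qed.

Lemma finitely_generated_prod (A B : bimodType R S) :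
  finitely_generated A -> finitely_generated B ->
  finitely_generated (A * B)%type.
Proof.
move=> [X gX] [Y gY]; exists ([seq (x, 0) | x <- X] ++ [seq (0, y) | y <- Y]).
case=> a b; rewrite (_ : (a, b) = (a, 0) + (0, b)); last first.
  by congr pair; rewrite ?addr0 ?add0r.
have [iA iAE] := bimod_inl A B; have [iB iBE] := bimod_inr A B.
apply: in_spanD.
- have [t [tX ->]] := gX a; rewrite -iAE linear_sum.
  exists [seq (u.1.1, (u.1.2, 0), u.2) | u <- t]; split.
    move=> y; rewrite -map_comp => /mapP[u tu ->]; rewrite mem_cat.
    by apply/orP; left; apply: (map_f (fun x => (x, 0))); apply/tX/map_f.
  rewrite big_map; apply: eq_bigr => u _ /=.
  by rewrite rscalable linearZ /= iAE.
- have [t [tX ->]] := gY b; rewrite -iBE linear_sum.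
  exists [seq (u.1.1, (0, u.1.2), u.2) | u <- t]; split.
    move=> y; rewrite -map_comp => /mapP[u tu ->]; rewrite mem_cat.
    by apply/orP; right; apply: (map_f (fun y => (0, y))); apply/tX/map_f.
  rewrite big_map; apply: eq_bigr => u _ /=.
  by rewrite rscalable linearZ /= iBE.
Qed.

End BimoduleTheory.

(** * Exactness of tensor products *)

Section Image.
Variables (R : pzRingType) (U V : lmodType R) (f : {linear U -> V}).

Definition image_pred : {pred V} := fun v => `[< exists u, f u = v >].

Fact image_submod_closed : submod_closed image_pred.
Proof.
split=> [|a v w /asboolP[x <-] /asboolP[y <-]]; apply/asboolP.
  by exists 0; rewrite linear0.
by exists (a *: x + y); rewrite linearP.
Qed.

HB.instance Definition _ :=
  GRing.isSubmodClosed.Build R V image_pred image_submod_closed.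

Inductive image : predArgType := Image v & v \in image_pred.
Definition image_val w : V := let: Image v _ := w in v.

HB.instance Definition _ := [isSub of image for image_val].
HB.instance Definition _ := [Choice of image by <:].
HB.instance Definition _ := [SubChoice_isSubZmodule of image by <:].
HB.instance Definition _ := [SubZmodule_isSubLmodule of image by <:].

Fact image_mem u : f u \in image_pred.
Proof. by apply/asboolP; exists u. Qed.

(** Flatness speaks only of injective maps; splitting an arbitrary map into a surjection and an
    injection makes it applicable. *)
Lemma image_factorization : exists (I : lmodType R)
  (p : {linear U -> I}) (i : {linear I -> V}),
  [/\ forall u, i (p u) = f u, injective i & forall y, exists u, p u = y].
Proof.
have pL : linear (fun u => Image (image_mem u)).
  by move=> a u v; apply: val_inj; rewrite /= linearP.
pose pM := GRing.isLinear.Build R U image *:%R _ pL.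
pose p : {linear U -> image} := HB.pack (fun u => Image (image_mem u)) pM.
exists image, p, (\val : {linear image -> V}); split=> //; first exact: val_inj.
case=> v Iv; have /asboolP[u fu] := Iv; exists u; exact: val_inj.
Qed.

End Image.

Section Cokernel.
Variables (U V : zmodType) (f : {additive U -> V}).

Definition zimage : {pred V} := fun v => `[< exists u, f u = v >].

Fact zimage_zmod_closed : zmod_closed zimage.
Proof.
split=> [|v w /asboolP[x <-] /asboolP[y <-]]; apply/asboolP.
  by exists 0; rewrite raddf0.
by exists (x - y); rewrite raddfB.
Qed.

HB.instance Definition _ :=
  GRing.isZmodClosed.Build V zimage zimage_zmod_closed.

Lemma cokernel : exists (Q : zmodType) (q : {additive V -> Q}),
  forall v, q v = 0 <-> exists u, f u = v.
Proof.
pose q : {additive V -> Quotient.quot zimage} := \pi_(Quotient.quot zimage)%qT.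
exists (Quotient.quot zimage), q => v.
rewrite -(raddf0 q) /q; split=> [/eqP|fv].
  by rewrite -(Quotient.idealrBE zimage) subr0 => /asboolP.
by apply/eqP; rewrite -(Quotient.idealrBE zimage) subr0; apply/asboolP.
Qed.

End Cokernel.

Section PureTheory.
Variables (R : pzRingType) (A : lmodType R^c) (B : lmodType R).

Lemma pureDl (x1 x2 : A) (y : B) : pure (x1 + x2) y = pure x1 y + pure x2 y.
Proof. by case: (pure_balanced A B). Qed.

Lemma pureDr (x : A) (y1 y2 : B) : pure x (y1 + y2) = pure x y1 + pure x y2.
Proof. by case: (pure_balanced A B). Qed.

Lemma pureZ (a : R) (x : A) (y : B) :
  pure ((a : R^c) *: x) y = pure x (a *: y).
Proof. by case: (pure_balanced A B). Qed.

Lemma pure0l (y : B) : pure (0 : A) y = 0.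
Proof. by apply: (addrI (pure 0 y)); rewrite -pureDl !addr0. Qed.

Lemma pure0r (x : A) : pure x (0 : B) = 0.
Proof. by apply: (addrI (pure x 0)); rewrite -pureDr !addr0. Qed.

Lemma pureBr (x : A) (y1 y2 : B) : pure x (y1 - y2) = pure x y1 - pure x y2.
Proof. by apply: (addIr (pure x y2)); rewrite -pureDr !subrK. Qed.

Lemma tensor_lift0 (G : zmodType) (b : A -> B -> G) :
  balanced b -> tensor_lift b 0 = 0.
Proof. by move/tensor_lift_zmod_morphism/(_ 0 0); rewrite !subrr. Qed.

End PureTheory.

Section TensorExactness.
Variable R : pzRingType.

Section TensorMapTheory.
Variables (A A' A'' : lmodType R^c) (B B' B'' : lmodType R).

Lemma eq_tensor_map (f f' : {linear A -> A'}) (g g' : {linear B -> B'}) :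
  f =1 f' -> g =1 g' -> tensor_map f g =1 tensor_map f' g'.
Proof.
move=> ef eg; elim/tensor_ind => [|x y|u v Eu Ev]; first by rewrite !raddf0.
  by rewrite !tensor_map_pure ef eg.
by rewrite !raddfB /= Eu Ev.
Qed.

Lemma tensor_map_comp (f : {linear A' -> A''}) (f' : {linear A -> A'})
    (g : {linear B' -> B''}) (g' : {linear B -> B'}) :
  tensor_map f g \o tensor_map f' g' =1 tensor_map (f \o f') (g \o g').
Proof.
elim/tensor_ind => [|x y|u v Eu Ev]; first by rewrite !raddf0.
  by rewrite /= !tensor_map_pure.
by move: Eu Ev => /= Eu Ev; rewrite !raddfB /= Eu Ev.
Qed.

Lemma tensor_map_id :
  tensor_map (idfun : {linear A -> A}) (idfun : {linear B -> B}) =1 id.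
Proof.
elim/tensor_ind => [|x y|u v Eu Ev]; first by rewrite !raddf0.
  by rewrite tensor_map_pure.
by rewrite raddfB /= Eu Ev.
Qed.

End TensorMapTheory.

(** Let Q be the cokernel of F (x) f. Sending x (x) p(b) to the class of x (x) b is well defined
    because the kernel of p is covered by f. The resulting map from F (x) C to Q, composed with F
    (x) p, is the quotient map q, so whatever F (x) p kills is killed by q and comes from F (x)
    f. *)
Lemma tensor_right_exact_r (F : lmodType R^c) (B' B C : lmodType R)
    (f : {linear B' -> B}) (p : {linear B -> C}) :
  (forall b, p b = 0 -> exists b', f b' = b) ->
  (forall c, exists b, p b = c) ->
  forall u, tensor_map (idfun : {linear F -> F}) p u = 0 ->
    exists u', tensor_map (idfun : {linear F -> F}) f u' = u.
Proof.
move=> ex sp u pu0.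
have [Q [q qP]] := cokernel (tensor_map (idfun : {linear F -> F}) f).
have qeq x b b' : p b = p b' -> q (pure x b) = q (pure x b').
  move=> /eqP; rewrite -subr_eq0 -linearB => /eqP/ex[d fd].
  have -> : b = b' + f d by rewrite fd addrC subrK.
  rewrite pureDr raddfD (_ : q (pure x (f d)) = 0) ?addr0 //.
  by apply/qP; exists (pure x d); rewrite /= tensor_map_pure.
(* The section [s] of [p] need not be additive; [b] is balanced all the same, since by [qeq] the
   class depends only on the image under [p]. *)
have [s sK] := choice sp.
pose b x c := q (pure x (s c)).
have bb : balanced b.
  split=> [x1 x2 y|x y1 y2|a x y]; rewrite /b.
  - by rewrite pureDl raddfD.
  - by rewrite -raddfD -pureDr; apply: qeq; rewrite linearD /= !sK.
  - by rewrite pureZ; apply: qeq; rewrite linearZ /= !sK.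
apply/qP; suff <- : tensor_lift b (tensor_map idfun p u) = q u.
  by rewrite pu0 tensor_lift0.
elim/tensor_ind: {pu0}u => [|x y|u v Eu Ev].
- by rewrite !raddf0 tensor_lift0.
- by rewrite tensor_map_pure tensor_lift_pure //; apply: qeq; rewrite sK.
- by rewrite !raddfB (tensor_lift_zmod_morphism bb) Eu Ev.
Qed.

Lemma tensor_right_exact_l (F : lmodType R) (A' A C : lmodType R^c)
    (f : {linear A' -> A}) (p : {linear A -> C}) :
  (forall a, p a = 0 -> exists a', f a' = a) ->
  (forall c, exists a, p a = c) ->
  forall u, tensor_map p (idfun : {linear F -> F}) u = 0 ->
    exists u', tensor_map f (idfun : {linear F -> F}) u' = u.
Proof.
move=> ex sp u pu0.
have [Q [q qP]] := cokernel (tensor_map f (idfun : {linear F -> F})).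
have qeq y a a' : p a = p a' -> q (pure a y) = q (pure a' y).
  move=> /eqP; rewrite -subr_eq0 -linearB => /eqP/ex[d fd].
  have -> : a = a' + f d by rewrite fd addrC subrK.
  rewrite pureDl raddfD (_ : q (pure (f d) y) = 0) ?addr0 //.
  by apply/qP; exists (pure d y); rewrite /= tensor_map_pure.
have [s sK] := choice sp.
pose b c y := q (pure (s c) y).
have bb : balanced b.
  split=> [x1 x2 y|x y1 y2|a x y]; rewrite /b.
  - by rewrite -raddfD -pureDl; apply: qeq; rewrite linearD /= !sK.
  - by rewrite pureDr raddfD.
  - by rewrite -pureZ; apply: qeq; rewrite linearZ /= !sK.
apply/qP; suff <- : tensor_lift b (tensor_map p idfun u) = q u.
  by rewrite pu0 tensor_lift0.
elim/tensor_ind: {pu0}u => [|x y|u v Eu Ev].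
- by rewrite !raddf0 tensor_lift0.
- by rewrite tensor_map_pure tensor_lift_pure //; apply: qeq; rewrite sK.
- by rewrite !raddfB (tensor_lift_zmod_morphism bb) Eu Ev.
Qed.

(** Factor g through its image as i p. Flatness makes F (x) i injective, so F (x) g and F (x) p have
    the same kernel, and right exactness identifies it. *)
Lemma right_flat_exact (F : lmodType R^c) (B' B B'' : lmodType R)
    (f : {linear B' -> B}) (g : {linear B -> B''}) : right_flat F ->
  (forall b, g b = 0 <-> exists b', f b' = b) ->
  forall u, tensor_map (idfun : {linear F -> F}) g u = 0 <->
    exists u', tensor_map (idfun : {linear F -> F}) f u' = u.
Proof.
move=> flatF ex u; have [I [p [i [ip inj_i surj_p]]]] := image_factorization g.
split=> [gu0|[{}u <-]]; last first.
  elim/tensor_ind: u => [|x y|u v Eu Ev]; first by rewrite !raddf0.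
    rewrite !tensor_map_pure (_ : g (f y) = 0); last by apply/ex; exists y.
    exact: pure0r.
  by rewrite !raddfB /= Eu Ev subrr.
apply: (tensor_right_exact_r (p := p)) => // [b pb0|].
  by apply/ex; rewrite -ip pb0 linear0.
apply: (flatF _ _ i inj_i); rewrite raddf0 -gu0.
rewrite -[LHS]/((tensor_map _ i \o tensor_map _ p) u) tensor_map_comp.
exact: eq_tensor_map.
Qed.

Lemma left_flat_exact (F : lmodType R) (A' A A'' : lmodType R^c)
    (f : {linear A' -> A}) (g : {linear A -> A''}) : left_flat F ->
  (forall a, g a = 0 <-> exists a', f a' = a) ->
  forall u, tensor_map g (idfun : {linear F -> F}) u = 0 <->
    exists u', tensor_map f (idfun : {linear F -> F}) u' = u.
Proof.
move=> flatF ex u; have [I [p [i [ip inj_i surj_p]]]] := image_factorization g.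
split=> [gu0|[{}u <-]]; last first.
  elim/tensor_ind: u => [|x y|u v Eu Ev]; first by rewrite !raddf0.
    rewrite !tensor_map_pure (_ : g (f x) = 0); last by apply/ex; exists x.
    exact: pure0l.
  by rewrite !raddfB /= Eu Ev subrr.
apply: (tensor_right_exact_l (p := p)) => // [b pb0|].
  by apply/ex; rewrite -ip pb0 linear0.
apply: (flatF _ _ i inj_i); rewrite raddf0 -gu0.
rewrite -[LHS]/((tensor_map i _ \o tensor_map p _) u) tensor_map_comp.
exact: eq_tensor_map.
Qed.

(** Serves to carry flatness between two copies of S that are distinct types with the same right
    action. *)
Lemma right_flat_iso (F F' : lmodType R^c) (f : {linear F -> F'})
    (g : {linear F' -> F}) :
  cancel f g -> cancel g f -> right_flat F -> right_flat F'.
Proof.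
move=> fK gK flatF B B' h inj_h u v E.
have gI : injective (tensor_map g (idfun : {linear B -> B})).
  apply: (can_inj (g := tensor_map f (idfun : {linear B -> B}))) => w.
  rewrite -[LHS]/((tensor_map f _ \o tensor_map g _) w) tensor_map_comp.
  by rewrite -[RHS]tensor_map_id; apply: eq_tensor_map.
apply/gI/(flatF _ _ h inj_h).
rewrite -[LHS]/((tensor_map _ h \o tensor_map g _) u) tensor_map_comp.
rewrite -[RHS]/((tensor_map _ h \o tensor_map g _) v) tensor_map_comp.
have Ew w : tensor_map (idfun \o g) (h \o idfun) w =
    tensor_map g (idfun : {linear B' -> B'})
      (tensor_map (idfun : {linear F' -> F'}) h w).
  rewrite -[RHS]/((tensor_map g _ \o tensor_map _ h) w) tensor_map_comp.
  exact: eq_tensor_map.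
by rewrite !Ew E.
Qed.

End TensorExactness.

(** * Tensor products of bimodules *)

(* The right module underlying a bimodule, as a left module over [S^c]. *)
Definition rmod (R S : pzRingType) (V : bimodType R S) : Type := V.

Section RightModule.
Variables (R S : pzRingType) (V : bimodType R S).

HB.instance Definition _ := GRing.Zmodule.on (rmod V).

Definition rmod_scale (b : S^c) (v : rmod V) : rmod V := (v : V) *< (b : S).

Fact rmod_scaleA a b v : rmod_scale a (rmod_scale b v) = rmod_scale (a * b) v.
Proof. exact: rscalerA. Qed.

Fact rmod_scale1 : left_id 1 rmod_scale.
Proof. exact: rscaler1. Qed.

Fact rmod_scaleDr : right_distributive rmod_scale +%R.
Proof. by move=> a u v; apply: rscalerDl. Qed.

Fact rmod_scaleDl v : {morph rmod_scale^~ v : a b / a + b}.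
Proof. by move=> a b; exact: (@rscalerDr _ _ V v a b). Qed.

HB.instance Definition _ := GRing.Zmodule_isLmodule.Build S^c (rmod V)
  rmod_scaleA rmod_scale1 rmod_scaleDr rmod_scaleDl.

End RightModule.

Definition rmap (R S : pzRingType) (U V : bimodType R S) (f : {bimod U -> V}) :
  rmod U -> rmod V := f.

HB.instance Definition _ (R S : pzRingType) (U V : bimodType R S)
  (f : {bimod U -> V}) :=
  GRing.isZmodMorphism.Build (rmod U) (rmod V) (rmap f) (raddfB f).
HB.instance Definition _ (R S : pzRingType) (U V : bimodType R S)
  (f : {bimod U -> V}) :=
  GRing.isScalable.Build S^c (rmod U) (rmod V) *:%R (rmap f)
    (fun b u => rscalable f u b).

Section BimoduleTensor.
Variables (T R S : pzRingType) (X : bimodType T R) (Y : bimodType R S).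

Definition btensor : Type := tensor (rmod X) Y.

HB.instance Definition _ := GRing.Zmodule.on btensor.

Definition lact (t : T) (x : rmod X) : rmod X := t *: (x : X).

Fact lact_is_zmod_morphism t : zmod_morphism (lact t).
Proof. by move=> x y; exact: (@scalerBr _ X t x y). Qed.

Fact lact_is_scalable t : scalable (lact t).
Proof. by move=> a x; exact: (@scaler_rscaler _ _ X t x a). Qed.

HB.instance Definition _ t := GRing.isZmodMorphism.Build (rmod X) (rmod X)
  (lact t) (lact_is_zmod_morphism t).
HB.instance Definition _ t := GRing.isScalable.Build R^c (rmod X) (rmod X) *:%R
  (lact t) (lact_is_scalable t).

Definition btensor_scale (t : T) (u : btensor) : btensor :=
  tensor_map (lact t) idfun u.
Definition btensor_rscale (u : btensor) (b : S) : btensor :=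
  tensor_map idfun (rscaleBy b : {linear Y -> Y}) u.

Fact btensor_scaleDr : right_distributive btensor_scale +%R.
Proof. by move=> t u v; apply: raddfD. Qed.

Fact btensor_rscalerDl b : {morph btensor_rscale^~ b : u v / u + v}.
Proof. by move=> u v; apply: raddfD. Qed.

Lemma btensor_ind (P : btensor -> Prop) :
  P 0 -> (forall x y, P (pure (x : rmod X) (y : Y))) ->
  (forall u v, P u -> P v -> P (u - v)) -> forall u, P u.
Proof. exact: tensor_ind. Qed.

Fact btensor_scaleE t x y :
  btensor_scale t (pure (x : rmod X) y) = pure (t *: (x : X) : rmod X) y.
Proof. exact: tensor_map_pure. Qed.

Fact btensor_rscaleE (x : rmod X) y b :
  btensor_rscale (pure x y) b = pure x (y *< b).
Proof. exact: tensor_map_pure. Qed.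

Fact btensor_scale0 t : btensor_scale t 0 = 0.
Proof. exact: raddf0. Qed.

Fact btensor_scaleB t u v :
  btensor_scale t (u - v) = btensor_scale t u - btensor_scale t v.
Proof. exact: raddfB. Qed.

Fact btensor_rscale0 b : btensor_rscale 0 b = 0.
Proof. exact: raddf0. Qed.

Fact btensor_rscaleB u v b :
  btensor_rscale (u - v) b = btensor_rscale u b - btensor_rscale v b.
Proof. exact: raddfB. Qed.

Fact btensor_scaleA a b u :
  btensor_scale a (btensor_scale b u) = btensor_scale (a * b) u.
Proof.
elim/btensor_ind: u => [|x y|u v Eu Ev]; first by rewrite !btensor_scale0.
  by rewrite !btensor_scaleE scalerA.
by rewrite !btensor_scaleB Eu Ev.
Qed.

Fact btensor_scale1 : left_id 1 btensor_scale.
Proof.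
elim/btensor_ind => [|x y|u v Eu Ev]; first by rewrite !btensor_scale0.
  by rewrite !btensor_scaleE scale1r.
by rewrite !btensor_scaleB Eu Ev.
Qed.

Fact btensor_scaleDl u : {morph btensor_scale^~ u : a b / a + b}.
Proof.
move=> a b; elim/btensor_ind: u => [|x y|u v Eu Ev].
- by rewrite !btensor_scale0 addr0.
- by rewrite !btensor_scaleE scalerDl -pureDl.
- by rewrite !btensor_scaleB Eu Ev opprD addrACA.
Qed.

HB.instance Definition _ := GRing.Zmodule_isLmodule.Build T btensor
  btensor_scaleA btensor_scale1 btensor_scaleDr btensor_scaleDl.

Fact btensor_rscalerA u a b :
  btensor_rscale (btensor_rscale u a) b = btensor_rscale u (a * b).
Proof.
elim/btensor_ind: u => [|x y|u v Eu Ev]; first by rewrite !btensor_rscale0.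
  by rewrite !btensor_rscaleE rscalerA.
by rewrite !btensor_rscaleB Eu Ev.
Qed.

Fact btensor_rscaler1 u : btensor_rscale u 1 = u.
Proof.
elim/btensor_ind: u => [|x y|u v Eu Ev]; first by rewrite !btensor_rscale0.
  by rewrite !btensor_rscaleE rscaler1.
by rewrite !btensor_rscaleB Eu Ev.
Qed.

Fact btensor_rscalerDr u : {morph btensor_rscale u : a b / a + b}.
Proof.
move=> a b; elim/btensor_ind: u => [|x y|u v Eu Ev].
- by rewrite !btensor_rscale0 addr0.
- by rewrite !btensor_rscaleE rscalerDr -pureDr.
- by rewrite !btensor_rscaleB Eu Ev opprD addrACA.
Qed.

Fact btensor_scaler_rscaler a u b :
  btensor_scale a (btensor_rscale u b) = btensor_rscale (btensor_scale a u) b.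
Proof.
elim/btensor_ind: u => [|x y|u v Eu Ev].
- by rewrite btensor_rscale0 btensor_scale0 btensor_rscale0.
- by rewrite btensor_rscaleE !btensor_scaleE btensor_rscaleE.
- by rewrite btensor_rscaleB !btensor_scaleB btensor_rscaleB Eu Ev.
Qed.

HB.instance Definition _ := Lmodule_isBimodule.Build T S btensor
  btensor_rscalerA btensor_rscaler1 btensor_rscalerDl btensor_rscalerDr
  btensor_scaler_rscaler.

Definition bpure (x : X) (y : Y) : btensor := pure (x : rmod X) y.

Lemma scale_bpure t x y : t *: bpure x y = bpure (t *: x) y.
Proof. exact: btensor_scaleE. Qed.

Lemma rscale_bpure x y b : bpure x y *< b = bpure x (y *< b).
Proof. exact: btensor_rscaleE. Qed.

Lemma bpure_middle x (a : R) y : bpure (x *< a) y = bpure x (a *: y).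
Proof. exact: pureZ. Qed.

End BimoduleTensor.

Arguments bpure {T R S X Y} x y.

Section BimoduleTensorMap.
Variables (T R S : pzRingType).
Variables (X X' : bimodType T R) (Y Y' : bimodType R S).
Variables (f : {bimod X -> X'}) (g : {bimod Y -> Y'}).

Definition btensor_map : btensor X Y -> btensor X' Y' :=
  tensor_map (rmap f : {linear rmod X -> rmod X'}) g.

Fact btensor_map_is_zmod_morphism : zmod_morphism btensor_map.
Proof. by move=> u v; apply: raddfB. Qed.

HB.instance Definition _ := GRing.isZmodMorphism.Build
  (btensor X Y) (btensor X' Y') btensor_map btensor_map_is_zmod_morphism.

Lemma btensor_map_pure x y : btensor_map (bpure x y) = bpure (f x) (g y).
Proof. exact: tensor_map_pure. Qed.

Fact btensor_map_is_scalable : scalable btensor_map.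
Proof.
move=> t; elim/btensor_ind => [|x y|u v Eu Ev].
- by rewrite scaler0 raddf0 scaler0.
- rewrite -/(bpure (x : X) y) scale_bpure !btensor_map_pure scale_bpure.
  by rewrite linearZ.
- by rewrite scalerBr !raddfB /= Eu Ev.
Qed.

Fact btensor_map_is_rscalable u b : btensor_map (u *< b) = btensor_map u *< b.
Proof.
elim/btensor_ind: u => [|x y|u v Eu Ev].
- by rewrite rscale0r raddf0 rscale0r.
- rewrite -/(bpure (x : X) y) rscale_bpure !btensor_map_pure rscale_bpure.
  by rewrite rscalable.
- by rewrite rscaleBr !raddfB /= rscaleBr Eu Ev.
Qed.

HB.instance Definition _ := GRing.isScalable.Build T
  (btensor X Y) (btensor X' Y') *:%R btensor_map btensor_map_is_scalable.
HB.instance Definition _ := isRightScalable.Build T S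
  (btensor X Y) (btensor X' Y') btensor_map btensor_map_is_rscalable.

End BimoduleTensorMap.

(** * Base change of bimodules *)

(* [S] as an [(S, R)]-bimodule; as an [(R, S)]-bimodule it is                 *)
(* [left_restr phi].                                                          *)
Definition ext_bimod (R S : pzRingType) (phi : {rmorphism R -> S}) : Type :=
  S^o.

Definition restr_bimod (R S : pzRingType) (phi : {rmorphism R -> S})
  (V : bimodType S S) : Type := V.

Section RestrictionBimodules.
Variables (R S : pzRingType) (phi : {rmorphism R -> S}).
Local Notation X := (ext_bimod phi).
Local Notation Y := (left_restr phi).

HB.instance Definition _ := GRing.Lmodule.on X.

Definition ext_rscale (x : X) (a : R) : X := (x : S) * phi a.

Fact ext_rscalerA x a b : ext_rscale (ext_rscale x a) b = ext_rscale x (a * b).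
Proof. by rewrite /ext_rscale rmorphM mulrA. Qed.

Fact ext_rscaler1 x : ext_rscale x 1 = x.
Proof. by rewrite /ext_rscale rmorph1 mulr1. Qed.

Fact ext_rscalerDl a : {morph ext_rscale^~ a : x y / x + y}.
Proof. by move=> x y; exact: (@mulrDl S x y (phi a)). Qed.

Fact ext_rscalerDr x : {morph ext_rscale x : a b / a + b}.
Proof. by move=> a b; rewrite /ext_rscale rmorphD; exact: (@mulrDr S). Qed.

Fact ext_scaler_rscaler (s : S) x a :
  s *: ext_rscale x a = ext_rscale (s *: x) a.
Proof. exact: (@mulrA S). Qed.

HB.instance Definition _ := Lmodule_isBimodule.Build S R X
  ext_rscalerA ext_rscaler1 ext_rscalerDl ext_rscalerDr ext_scaler_rscaler.

Definition left_restr_rscale (y : Y) (s : S) : Y := (y : S) * s.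

Fact left_restr_rscalerA y s t :
  left_restr_rscale (left_restr_rscale y s) t = left_restr_rscale y (s * t).
Proof. exact/esym/(@mulrA S). Qed.

Fact left_restr_rscaler1 y : left_restr_rscale y 1 = y.
Proof. exact: (@mulr1 S). Qed.

Fact left_restr_rscalerDl s : {morph left_restr_rscale^~ s : y z / y + z}.
Proof. by move=> y z; exact: (@mulrDl S). Qed.

Fact left_restr_rscalerDr y : {morph left_restr_rscale y : s t / s + t}.
Proof. by move=> s t; exact: (@mulrDr S). Qed.

Fact left_restr_scaler_rscaler (a : R) y s :
  a *: left_restr_rscale y s = left_restr_rscale (a *: y) s.
Proof. exact: (@mulrA S). Qed.

HB.instance Definition _ := Lmodule_isBimodule.Build R S Y
  left_restr_rscalerA left_restr_rscaler1 left_restr_rscalerDl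
  left_restr_rscalerDr left_restr_scaler_rscaler.

Lemma ext_bimod_right_flat :
  right_flat (right_restr phi) -> right_flat (rmod X).
Proof.
pose f (x : right_restr phi) : rmod X := x.
pose g (x : rmod X) : right_restr phi := x.
have fL : linear f by move=> a x y.
have gL : linear g by move=> a x y.
pose fM := GRing.isLinear.Build R^c (right_restr phi) (rmod X) *:%R _ fL.
pose gM := GRing.isLinear.Build R^c (rmod X) (right_restr phi) *:%R _ gL.
pose f' : {linear right_restr phi -> rmod X} := HB.pack f fM.
pose g' : {linear rmod X -> right_restr phi} := HB.pack g gM.
exact: (@right_flat_iso _ _ _ f' g').
Qed.

Section RestrBimod.
Variable V : bimodType S S.
Local Notation W := (restr_bimod phi V).

HB.instance Definition _ := GRing.Zmodule.on W.

Definition restr_scale (a : R) (v : W) : W := phi a *: (v : V).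
Definition restr_rscale (v : W) (a : R) : W := (v : V) *< phi a.

Fact restr_scaleA a b v :
  restr_scale a (restr_scale b v) = restr_scale (a * b) v.
Proof. by rewrite /restr_scale rmorphM scalerA. Qed.

Fact restr_scale1 : left_id 1 restr_scale.
Proof. by move=> v; rewrite /restr_scale rmorph1 scale1r. Qed.

Fact restr_scaleDr : right_distributive restr_scale +%R.
Proof. by move=> a u v; exact: (@scalerDr S V). Qed.

Fact restr_scaleDl v : {morph restr_scale^~ v : a b / a + b}.
Proof. by move=> a b; rewrite /restr_scale rmorphD; exact: (@scalerDl S V). Qed.

HB.instance Definition _ := GRing.Zmodule_isLmodule.Build R W
  restr_scaleA restr_scale1 restr_scaleDr restr_scaleDl.

Fact restr_rscalerA v a b :
  restr_rscale (restr_rscale v a) b = restr_rscale v (a * b).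
Proof. by rewrite /restr_rscale rmorphM rscalerA. Qed.

Fact restr_rscaler1 v : restr_rscale v 1 = v.
Proof. by rewrite /restr_rscale rmorph1 rscaler1. Qed.

Fact restr_rscalerDl a : {morph restr_rscale^~ a : u v / u + v}.
Proof. by move=> u v; exact: (@rscalerDl S S V). Qed.

Fact restr_rscalerDr v : {morph restr_rscale v : a b / a + b}.
Proof.
by move=> a b; rewrite /restr_rscale rmorphD; exact: (@rscalerDr S S V).
Qed.

Fact restr_scaler_rscaler (a : R) v b :
  a *: restr_rscale v b = restr_rscale (a *: v) b.
Proof. exact: (@scaler_rscaler S S V). Qed.

HB.instance Definition _ := Lmodule_isBimodule.Build R R W
  restr_rscalerA restr_rscaler1 restr_rscalerDl restr_rscalerDr
  restr_scaler_rscaler.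

End RestrBimod.

(* [E] is [S (x)_R P (x)_R S], with [eta s p t] the pure tensor of [s], [p]   *)
(* and [t].                                                                   *)
Record is_base_change (P : bimodType R R) (E : bimodType S S)
    (eta : S -> P -> S -> E) : Prop := {
  bc_Bm : forall s p p' t, eta s (p - p') t = eta s p t - eta s p' t;
  bc_middlel : forall s a p t, eta s (a *: p) t = eta (s * phi a) p t;
  bc_middler : forall s p a t, eta s (p *< a) t = eta s p (phi a * t);
  bc_scale : forall s' s p t, s' *: eta s p t = eta (s' * s) p t;
  bc_rscale : forall s p t t', eta s p t *< t' = eta s p (t * t');
  bc_ind : forall Q : E -> Prop, Q 0 -> (forall s p t, Q (eta s p t)) ->
    (forall u v, Q u -> Q v -> Q (u - v)) -> forall u, Q u;
  bc_lift : forall (G : zmodType) (f : S -> P -> S -> G),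
    (forall s s' p t, f (s + s') p t = f s p t + f s' p t) ->
    (forall s p p' t, f s (p + p') t = f s p t + f s p' t) ->
    (forall s p t t', f s p (t + t') = f s p t + f s p t') ->
    (forall s a p t, f s (a *: p) t = f (s * phi a) p t) ->
    (forall s a p t, f s (p *< a) t = f s p (phi a * t)) ->
    exists F : {additive E -> G}, forall s p t, F (eta s p t) = f s p t
}.

Section BaseChange.
Variable P : bimodType R R.

Definition base_change : bimodType S S := btensor X (btensor P Y).

Definition bc_pure (s : S) (p : P) (t : S) : base_change :=
  bpure (s : X) (bpure p (t : Y)).

Lemma bc_pureBm s p p' t :
  bc_pure s (p - p') t = bc_pure s p t - bc_pure s p' t.
Proof.
apply: (addIr (bc_pure s p' t)); rewrite subrK.
rewrite -[LHS](pureDr (A := rmod X)); congr pure.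
by rewrite -[LHS](pureDl (A := rmod P)); congr pure; exact: (@subrK P).
Qed.

Lemma bc_pure_scalel s a p t : bc_pure s (a *: p) t = bc_pure (s * phi a) p t.
Proof.
by rewrite /bc_pure -[in LHS]scale_bpure -bpure_middle.
Qed.

Lemma bc_pure_scaler s p a t : bc_pure s (p *< a) t = bc_pure s p (phi a * t).
Proof. by rewrite /bc_pure bpure_middle. Qed.

Lemma scale_bc_pure s' s p t : s' *: bc_pure s p t = bc_pure (s' * s) p t.
Proof. exact: scale_bpure. Qed.

Lemma rscale_bc_pure s p t t' : bc_pure s p t *< t' = bc_pure s p (t * t').
Proof. by rewrite [LHS]rscale_bpure rscale_bpure. Qed.

Lemma base_change_ind (Q : base_change -> Prop) :
  Q 0 -> (forall s p t, Q (bc_pure s p t)) ->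
  (forall u v, Q u -> Q v -> Q (u - v)) -> forall u, Q u.
Proof.
move=> Q0 Qp QB; apply: btensor_ind => // x; apply: btensor_ind.
- by rewrite pure0r.
- by move=> p t; apply: Qp.
- by move=> u v Qu Qv; rewrite pureBr; apply: QB.
Qed.

Section Lift.
Variables (G : zmodType) (f : S -> P -> S -> G).
Hypotheses (fl : forall s s' p t, f (s + s') p t = f s p t + f s' p t)
  (fm : forall s p p' t, f s (p + p') t = f s p t + f s p' t)
  (fr : forall s p t t', f s p (t + t') = f s p t + f s p t')
  (fal : forall s a p t, f s (a *: p) t = f (s * phi a) p t)
  (far : forall s a p t, f s (p *< a) t = f s p (phi a * t)).

(** For fixed s, the map f s is balanced and lifts to the inner tensor product; the lifts, as s
    varies, are balanced for the outer one. *)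
Lemma base_change_lift :
  exists F : {additive base_change -> G},
    forall s p t, F (bc_pure s p t) = f s p t.
Proof.
have bal s : @balanced R (rmod P) Y G (f s).
  by split=> [x1 x2 y|x y1 y2|a x y]; [apply: fm|apply: fr|apply: far].
pose h s : tensor (rmod P) Y -> G := @tensor_lift R (rmod P) Y G (f s).
have hB s : zmod_morphism (h s) := tensor_lift_zmod_morphism (bal s).
have hp s p t : h s (bpure p (t : Y)) = f s p t by exact: tensor_lift_pure.
have h0 s : h s 0 = 0 by have := hB s 0 0; rewrite !subrr.
have hD s u v : h s (u + v) = h s u + h s v.
  by apply: (addIr (- h s v)); rewrite -hB !addrK.
have balh : @balanced R (rmod X) (btensor P Y) G h.
  split=> [x1 x2|x y1 y2|a x]; last 1 first.
  - elim/btensor_ind => [|p t|u v Eu Ev]; first by rewrite scaler0 !h0.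
      rewrite -/(bpure (p : P) t) scale_bpure !hp fal.
      by rewrite /GRing.scale.
    by rewrite scalerBr !hB Eu Ev.
  - elim/btensor_ind => [|p t|u v Eu Ev]; first by rewrite !h0 addr0.
      by rewrite -/(bpure (p : P) t) !hp fl.
    by rewrite !hB Eu Ev opprD addrACA.
  - exact: hD.
pose FM := GRing.isZmodMorphism.Build _ _ _
  (@tensor_lift_zmod_morphism R (rmod X) (btensor P Y) G h balh).
pose F : {additive base_change -> G} := HB.pack
  (@tensor_lift R (rmod X) (btensor P Y) G h : base_change -> G) FM.
by exists F => s p t; rewrite [LHS]tensor_lift_pure // hp.
Qed.

End Lift.

Lemma base_change_is_base_change : is_base_change bc_pure.
Proof.
split.
- exact: bc_pureBm.
- exact: bc_pure_scalel.
- exact: bc_pure_scaler.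
- exact: scale_bc_pure.
- exact: rscale_bc_pure.
- exact: base_change_ind.
- exact: base_change_lift.
Qed.

End BaseChange.

Section BaseChangeMap.

Definition base_change_map (P Q : bimodType R R) (f : {bimod P -> Q}) :
    {bimod base_change P -> base_change Q} :=
  btensor_map (idfun : {bimod X -> X})
    (btensor_map f (idfun : {bimod Y -> Y})).

Lemma base_change_mapE (P Q : bimodType R R) (f : {bimod P -> Q}) s p t :
  base_change_map f (bc_pure s p t) = bc_pure s (f p) t.
Proof. by rewrite /bc_pure [LHS]btensor_map_pure /= btensor_map_pure. Qed.

Lemma base_change_map_surj (P Q : bimodType R R) (f : {bimod P -> Q}) :
  (forall q, exists p, f p = q) -> forall u, exists v, base_change_map f v = u.
Proof.
move=> sf; elim/base_change_ind => [|s q t|_ _ [u <-] [v <-]].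
- by exists 0; rewrite raddf0.
- by have [p <-] := sf q; exists (bc_pure s p t); rewrite base_change_mapE.
- by exists (u - v); rewrite raddfB.
Qed.

Hypotheses (flatl : left_flat (left_restr phi))
  (flatr : right_flat (right_restr phi)).

(** With the bracketing S (x) (P (x) S), the inner product keeps exactness by left flatness of S and
    the outer one by right flatness. *)
Lemma base_change_map_exact (P' P P'' : bimodType R R)
    (f : {bimod P' -> P}) (g : {bimod P -> P''}) :
  (forall x, g x = 0 <-> exists y, f y = x) ->
  forall u, base_change_map g u = 0 <-> exists v, base_change_map f v = u.
Proof.
move=> ex.
pose T (A B : bimodType R R) (h : {bimod A -> B}) :=
  btensor_map h (idfun : {bimod Y -> Y}).
have exY w : T _ _ g w = 0 <-> exists v, T _ _ f v = w.
  exact: (@left_flat_exact R Y _ _ _ (rmap f : {linear rmod P' -> rmod P})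
    (rmap g : {linear rmod P -> rmod P''}) flatl ex).
have := @right_flat_exact R (rmod X) _ _ _ (T _ _ f) (T _ _ g)
  (ext_bimod_right_flat flatr) exY.
pose fX := (rmap (idfun : {bimod X -> X}) : {linear rmod X -> rmod X}).
(* The two maps differ only in how the identity of the left factor is packaged as a linear map. *)
have E (A B : bimodType R R) (h : {bimod A -> B}) :
    base_change_map h =1
      tensor_map (idfun : {linear rmod X -> rmod X}) (T _ _ h).
  move=> v; exact: (@eq_tensor_map _ _ _ _ _ fX idfun (T _ _ h) (T _ _ h)).
move=> exX u; rewrite E; split=> [/exX[v <-]|[v vu]].
  by exists v; rewrite E.
by apply/exX; exists v; rewrite -E.
Qed.

End BaseChangeMap.
End RestrictionBimodules.

(** * Base change as left adjoint of restriction of scalars *)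

Section Adjunction.
Variables (R S : pzRingType) (phi : {rmorphism R -> S}).
Variables (P : bimodType R R) (E : bimodType S S) (eta : S -> P -> S -> E).
Hypothesis bcE : is_base_change phi eta.

Lemma bc_pureE s p t : eta s p t = s *: eta 1 p 1 *< t.
Proof. by rewrite (bc_scale bcE) (bc_rscale bcE) mulr1 mul1r. Qed.

(** The unit of the adjunction; [bc_adj] is the transposition of maps in the other direction. *)
Lemma bc_unit :
  exists h : {bimod P -> restr_bimod phi E}, forall p, h p = eta 1 p 1.
Proof.
pose h p : restr_bimod phi E := eta 1 p 1.
have hB : zmod_morphism h by move=> p q; apply: (bc_Bm bcE).
have hZ : scalable h.
  move=> a p; rewrite [LHS](bc_middlel bcE) mul1r.
  by rewrite [RHS](bc_scale bcE (phi a)) mulr1.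
have hr p a : h (p *< a) = h p *< a.
  rewrite [LHS](bc_middler bcE) mulr1.
  by rewrite [RHS](bc_rscale bcE _ _ _ (phi a)) mul1r.
by exists (bimod_mor hB hZ hr).
Qed.

Lemma bc_adj (V : bimodType S S) (f : {bimod P -> restr_bimod phi V}) :
  exists h : {bimod E -> V},
    forall s p t, h (eta s p t) = s *: (f p : V) *< t.
Proof.
pose k s p t : V := s *: (f p : V) *< t.
have [|s p p' t||s a p t|s a p t|F FE] := bc_lift bcE (f := k).
- by move=> *; rewrite /k scalerDl rscalerDl.
- by rewrite /k raddfD [X in X *< _](@scalerDr S V) rscalerDl.
- by move=> *; rewrite /k rscalerDr.
- by rewrite /k linearZ /= -scalerA.
- by rewrite /k rscalable -rscalerA scaler_rscaler.
have FZ : scalable F.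
  move=> s; elim/(bc_ind bcE) => [|s' p t|u v Eu Ev].
  - by rewrite !(scaler0, raddf0).
  - by rewrite (bc_scale bcE) !FE /k scaler_rscaler scalerA.
  - by rewrite scalerBr !raddfB /= Eu Ev.
have Fr u s : F (u *< s) = F u *< s.
  elim/(bc_ind bcE): u => [|s' p t|u v Eu Ev].
  - by rewrite !(rscale0r, raddf0).
  - by rewrite (bc_rscale bcE) !FE /k rscalerA.
  - by rewrite rscaleBr !raddfB /= rscaleBr Eu Ev.
by exists (bimod_mor (raddfB F) FZ Fr).
Qed.

(** A left adjoint preserves projectives when its right adjoint preserves surjections, and
    restriction of scalars leaves the underlying function unchanged. So [f] is transposed to [P],
    lifted there along the restriction of [g], and transposed back. *)
Lemma bc_projective : projective P -> projective E.
Proof.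
move=> projP U V g f sg.
have [u uE] := bc_unit.
pose fu p : restr_bimod phi V := f (u p).
have fuB : zmod_morphism fu by move=> p q; rewrite /fu raddfB [LHS]raddfB.
have fuZ : scalable fu by move=> a p; rewrite /fu linearZ [LHS]linearZ.
have fur p a : fu (p *< a) = fu p *< a by rewrite /fu rscalable [LHS]rscalable.
pose g' (x : restr_bimod phi U) : restr_bimod phi V := g x.
have gB : zmod_morphism g' by move=> x y; exact: (raddfB g).
have gZ : scalable g' by move=> a x; exact: (linearZZ g (phi a) x).
have gr x a : g' (x *< a) = g' x *< a by exact: (rscalable g x (phi a)).
have [h hE] := projP _ _ (bimod_mor gB gZ gr) (bimod_mor fuB fuZ fur) sg.
have [k kE] := bc_adj h; exists k.
elim/(bc_ind bcE) => [|s p t|x y Ex Ey]; first by rewrite !raddf0.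
  rewrite kE (rscalable g) (linearZZ g) /=.
  have -> : g (h p) = f (eta 1 p 1).
    by rewrite [LHS]hE; exact: (congr1 f (uE p)).
  by rewrite -(linearZZ f) -(rscalable f) /= -bc_pureE.
by rewrite !raddfB /= Ex Ey.
Qed.

(** The elements 1 (x) x (x) 1, for x a generator of [P], generate: coefficients from R on either
    side of x move through [phi] into the outer factors. *)
Lemma bc_fg : finitely_generated P -> finitely_generated E.
Proof.
move=> [Xs gX]; exists [seq eta 1 x 1 | x <- Xs] => v.
rewrite -/(in_span _ v).
elim/(bc_ind bcE): v => [|s p t|u v]; [exact: in_span0| |exact: in_spanB].
have [l [lX ->]] := gX p; rewrite bc_pureE.
apply/in_span_rscale/in_spanZ; rewrite big_seq.
apply: (big_ind (fun q => in_span _ (eta 1 q 1))) => [|q q' Xq Xq'|w wl].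
- have := bc_Bm bcE 1 0 0 1; rewrite !subrr => ->; exact: in_span0.
- have -> : eta 1 (q + q') 1 = eta 1 q 1 + eta 1 q' 1.
    by apply: (addIr (- eta 1 q' 1)); rewrite -(bc_Bm bcE) !addrK.
  exact: in_spanD.
rewrite (bc_middler bcE) (bc_middlel bcE) mulr1 mul1r bc_pureE.
by apply/in_span_rscale/in_spanZ/in_span_mem/map_f/lX/map_f.
Qed.

End Adjunction.

(** * Induced resolutions and direct sums of resolutions *)

Section Resolutions.
Variables R S : pzRingType.

Lemma base_change_resolution (phi : {rmorphism R -> S})
    (V : bimodType R R) (P : projective_resolution V) :
  left_flat (left_restr phi) -> right_flat (right_restr phi) ->
  exists Q : projective_resolution (base_change phi V),
    forall i, finitely_generated (P i) -> finitely_generated (Q i).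
Proof.
move=> fl fr; unshelve eexists.
  exists (fun i => base_change phi (P i))
    (fun i => base_change_map phi (res_diff P i))
    (base_change_map phi (res_aug P)).
  - move=> i; apply/(bc_projective (base_change_is_base_change _ _)).
    exact: res_projective.
  - exact/base_change_map_surj/res_aug_surj.
  - exact/base_change_map_exact/res_exact0.
  - by move=> i; exact/base_change_map_exact/res_exact.
by move=> i; exact/(bc_fg (base_change_is_base_change _ _)).
Qed.

Lemma prod_resolution (U V : bimodType R S) (P : projective_resolution U)
    (Q : projective_resolution V) :
  exists T : projective_resolution (U * V)%type,
    forall i, finitely_generated (P i) -> finitely_generated (Q i) ->
      finitely_generated (T i).
Proof.
have prod_mor (A B A' B' : bimodType R S)
    (f : {bimod A -> A'}) (g : {bimod B -> B'}) :
    exists h : {bimod (A * B)%type -> (A' * B')%type},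
      forall w, h w = (f w.1, g w.2).
  have hB : zmod_morphism (fun w : A * B => (f w.1, g w.2)).
    by move=> v w; rewrite !raddfB.
  have hZ : scalable (fun w : A * B => (f w.1, g w.2)).
    by move=> a w; rewrite !linearZ.
  have hr (w : (A * B)%type) b :
      (f (w *< b).1, g (w *< b).2) = (f w.1, g w.2) *< b.
    by rewrite !rscalable.
  by exists (bimod_mor hB hZ hr).
have prod_exact (A B A' B' A'' B'' : bimodType R S)
    (f : {bimod A -> A'}) (g : {bimod B -> B'})
    (f' : {bimod A' -> A''}) (g' : {bimod B' -> B''})
    (h : {bimod (A * B)%type -> (A' * B')%type})
    (h' : {bimod (A' * B')%type -> (A'' * B'')%type}) :
    (forall w, h w = (f w.1, g w.2)) -> (forall w, h' w = (f' w.1, g' w.2)) ->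
    (forall x, f' x = 0 <-> exists y, f y = x) ->
    (forall x, g' x = 0 <-> exists y, g y = x) ->
    forall x, h' x = 0 <-> exists y, h y = x.
  move=> hE h'E exf exg [x y]; rewrite h'E; split=> [[/exf[a <-] /exg[b <-]]|].
    by exists (a, b); rewrite hE.
  case=> -[a b]; rewrite hE => -[ax bx]; congr pair.
    by apply/exf; exists a.
  by apply/exg; exists b.
pose D i := cid (prod_mor _ _ _ _ (res_diff P i) (res_diff Q i)).
pose d i := sval (D i); have dE i := svalP (D i).
have [e eE] := prod_mor _ _ _ _ (res_aug P) (res_aug Q).
unshelve eexists.
  exists (fun i => (P i * Q i)%type : bimodType R S) d e.
  - by move=> i; apply: projective_prod; apply: res_projective.
  - move=> [u v]; have [x <-] := res_aug_surj P u.
    have [y <-] := res_aug_surj Q v.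
    by exists (x, y); rewrite eE.
  - by apply: (prod_exact _ _ _ _ _ _ _ _ _ _ _ _ (dE 0) eE);
      [exact: res_exact0|exact: res_exact0].
  - by move=> i; apply: (prod_exact _ _ _ _ _ _ _ _ _ _ _ _ (dE i.+1) (dE i));
      [exact: res_exact|exact: res_exact].
by move=> i; apply: finitely_generated_prod.
Qed.

End Resolutions.

(** * Derivations out of a pushout *)

Section Derivations.
Variables (L : monoidType) (E : bimodType (monoid_ring L) (monoid_ring L)).

Definition derivation (M : monoidType) (j : M -> L) (d : M -> E) : Prop :=
  forall x y, d (x * y)%g = mr_of (j x) *: d y + d x *< mr_of (j y).

Lemma derivation0 (M : monoidType) (j : M -> L) : derivation j (fun _ => 0).
Proof. by move=> x y; rewrite scaler0 rscale0r addr0. Qed.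

(* A derivation [L -> E] is a section of the projection [crossed -> L]. *)
Definition crossed : Type := (L * E)%type.

HB.instance Definition _ := Choice.on crossed.

Definition crossed_mul (u v : crossed) : crossed :=
  ((u.1 * v.1)%g, mr_of u.1 *: v.2 + u.2 *< mr_of v.1).
Definition crossed_one : crossed := (1%g, 0).

Fact crossed_mulA : associative crossed_mul.
Proof.
case=> x a [y b] [z c]; rewrite /crossed_mul /=; congr pair.
  exact: mulgA.
rewrite !mr_ofM scalerDr rscalerDl scalerA rscalerA addrA.
by rewrite scaler_rscaler.
Qed.

Fact crossed_mul1 : left_id crossed_one crossed_mul.
Proof.
by case=> x a; rewrite /crossed_mul /= mul1g rscale0r addr0 (scale1r (a : E)).
Qed.

Fact crossed_1mul : right_id crossed_one crossed_mul.
Proof.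
by case=> x a; rewrite /crossed_mul /= mulg1 scaler0 add0r (rscaler1 (a : E)).
Qed.

HB.instance Definition _ :=
  isMonoid.Build crossed crossed_mulA crossed_mul1 crossed_1mul.

Lemma derivation1 (M : monoidType) (j : {monoid M -> L}) (d : M -> E) :
  derivation j d -> d 1%g = 0.
Proof.
move=> /(_ 1%g 1%g); rewrite mulg1 gmulf1 (scale1r (d _)) (rscaler1 (d _)).
by rewrite -[LHS]addr0 => /addrI.
Qed.

(** The Leibniz rule for [d] is exactly multiplicativity of the second component in [crossed]. *)
Lemma derivation_morphism (M : monoidType) (j : {monoid M -> L}) (d : M -> E) :
  derivation j d ->
  exists h : {monoid M -> crossed}, forall x, h x = (j x, d x).
Proof.
move=> dP; pose h x : crossed := (j x, d x).
have hM : monoid.monoid_morphism h.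
  split=> [|x y]; first by rewrite /h gmulf1 (derivation1 dP).
  by rewrite /h gmulfM dP.
pose hm := isUMagmaMorphism.Build _ _ h hM.
by exists (HB.pack h hm : {monoid M -> crossed}).
Qed.

Variables (W M1 M2 : monoidType).
Variables (i1 : {monoid W -> M1}) (i2 : {monoid W -> M2})
  (j1 : {monoid M1 -> L}) (j2 : {monoid M2 -> L}).
Hypothesis po : is_pushout i1 i2 j1 j2.

Lemma pushout_hom_ext (N : monoidType) (f g : {monoid L -> N}) :
  (forall x, f (j1 x) = g (j1 x)) -> (forall y, f (j2 y) = g (j2 y)) -> f =1 g.
Proof.
move=> E1 E2 z.
have [h [_ _ hU]] := po.2 N (f \o j1) (f \o j2) (fun w => congr1 f (po.1 w)).
by rewrite (hU f) ?(hU g) // => x; rewrite /= -?E1 -?E2.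
Qed.

Lemma derivation_ext (d d' : L -> E) : derivation id d -> derivation id d' ->
  (forall x, d (j1 x) = d' (j1 x)) -> (forall y, d (j2 y) = d' (j2 y)) ->
  d =1 d'.
Proof.
move=> dP d'P E1 E2 z.
have [h hE] := @derivation_morphism L idfun d dP.
have [h' h'E] := @derivation_morphism L idfun d' d'P.
have : h z = h' z.
  by apply: pushout_hom_ext => [x|y]; rewrite hE h'E ?E1 ?E2.
by rewrite hE h'E => -[].
Qed.

(** The homomorphisms to [crossed] attached to [d1] and [d2] agree on [W], so they induce one on
    [L]; its second component is the derivation sought. *)
Lemma pushout_derivation (d1 : M1 -> E) (d2 : M2 -> E) :
  derivation j1 d1 -> derivation j2 d2 -> (forall w, d1 (i1 w) = d2 (i2 w)) ->
  exists d, [/\ derivation id d, forall x, d (j1 x) = d1 x &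
    forall y, d (j2 y) = d2 y].
Proof.
move=> d1P d2P d12.
have [h1 h1E] := derivation_morphism d1P.
have [h2 h2E] := derivation_morphism d2P.
have [|h [hE1 hE2 _]] := po.2 _ h1 h2.
  by move=> w; rewrite h1E h2E po.1 d12.
pose p (u : crossed) : L := u.1.
have pM : monoid.monoid_morphism p by [].
pose pm := isUMagmaMorphism.Build _ _ p pM.
(* The first component of [h] is an endomorphism of [L] that fixes the images of [M1] and [M2],
   hence the identity. Without this, the Leibniz rule would be twisted by it. *)
have hp z : (h z).1 = z.
  apply: (@pushout_hom_ext _
    ((HB.pack p pm : {monoid crossed -> L}) \o h) idfun).
    by move=> x; rewrite /= /p hE1 h1E.
  by move=> y; rewrite /= /p hE2 h2E.
exists (fun z => (h z).2); split=> [x y|x|y]; last 2 first.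
- by rewrite hE1 h1E.
- by rewrite hE2 h2E.
rewrite gmulfM.
by rewrite -[LHS]/(mr_of (h x).1 *: (h y).2 + (h x).2 *< mr_of (h y).1) !hp.
Qed.

(** Both sides of the Leibniz rule are additive in [s] and in [t], so it suffices to have it on
    monoid elements. *)
Lemma derivation_lift (d : L -> E) : derivation id d ->
  exists D : {additive monoid_ring L -> E}, (forall x, D (mr_of x) = d x) /\
    forall s t, D (s * t) = s *: D t + D s *< t.
Proof.
move=> dP.
pose DM := GRing.isZmodMorphism.Build (monoid_ring L) E _ (zliftB d).
pose D : {additive monoid_ring L -> E} :=
  HB.pack (zlift d : monoid_ring L -> E) DM.
have DU x : D (mr_of x) = d x by exact: zliftU.
exists D; split=> // s t.
elim/mr_ind: s => [|x|s s' Es Es'].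
- by rewrite mul0r raddf0 scale0r rscale0r addr0.
- elim/mr_ind: t => [|y|t t' Et Et'].
  + by rewrite mulr0 raddf0 scaler0 rscaler0 addr0.
  + by rewrite -mr_ofM !DU dP.
  + by rewrite mulrBr !raddfB /= rscalerB Et Et' opprD addrACA.
- by rewrite mulrBl !raddfB /= scalerBl rscaleBr Es Es' opprD addrACA.
Qed.

End Derivations.

(** * The short exact sequence of a pushout *)

Section CentralGenerators.
Variables (R S : pzRingType) (phi : {rmorphism R -> S}).
Implicit Types V E : bimodType S S.

Definition central_along V (v : V) : Prop := forall r, phi r *: v = v *< phi r.

(* The universal property of [S (x)_R S], with [e] the pure tensor of [1] and *)
(* [1].                                                                       *)
Record central_universal E (e : E) : Prop := {
  cu_central : central_along e;
  cu_ind : forall Q : E -> Prop, Q 0 -> (forall s t, Q (s *: e *< t)) ->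
    (forall u v, Q u -> Q v -> Q (u - v)) -> forall u, Q u;
  cu_lift : forall (G : zmodType) (b : S -> S -> G),
    (forall s s' t, b (s + s') t = b s t + b s' t) ->
    (forall s t t', b s (t + t') = b s t + b s t') ->
    (forall s r t, b (s * phi r) t = b s (phi r * t)) ->
    exists F : {additive E -> G}, forall s t, F (s *: e *< t) = b s t
}.

(** The assignment of s v t to (s, t) is balanced precisely because R centralises v; so bimodule
    maps out of S (x)_R S amount to central elements of the target. *)
Lemma central_bimod E (e : E) V (v : V) : central_universal e ->
  central_along v -> exists h : {bimod E -> V}, h e = v.
Proof.
move=> eU vC; have [|||F FE] := cu_lift eU (b := fun s t => s *: v *< t).
- by move=> *; rewrite scalerDl rscalerDl.
- by move=> *; rewrite rscalerDr.
- by move=> s x t; rewrite -scalerA vC -!scaler_rscaler rscalerA.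
have FZ : scalable F.
  move=> s; elim/(cu_ind eU) => [|s' t|u u' Eu Eu'].
  - by rewrite !(scaler0, raddf0).
  - by rewrite scaler_rscaler scalerA !FE scaler_rscaler scalerA.
  - by rewrite scalerBr !raddfB /= Eu Eu'.
have Fr u s : F (u *< s) = F u *< s.
  elim/(cu_ind eU): u => [|s' t|u u' Eu Eu'].
  - by rewrite !(rscale0r, raddf0).
  - by rewrite rscalerA !FE rscalerA.
  - by rewrite rscaleBr !raddfB /= rscaleBr Eu Eu'.
exists (bimod_mor (raddfB F) FZ Fr).
have := FE 1 1; rewrite !rscaler1 (scale1r e) (scale1r v) => <-.
exact: bimod_morE.
Qed.

(** This is the identification of S (x)_R R (x)_R S with S (x)_R S: the middle factor is absorbed
    into the left one through [phi]. *)
Lemma base_change_central E (eta : S -> R^o -> S -> E) :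
  is_base_change phi eta -> central_universal (eta 1 1 1).
Proof.
move=> bcE; split=> [r|Q Q0 Qe QB|G b bl br bm].
- rewrite (bc_scale bcE) (bc_rscale bcE) mulr1 mul1r.
  have := bc_middlel bcE 1 r 1 1; rewrite mul1r => <-.
  have := bc_middler bcE 1 1 r 1; rewrite mulr1 => <-.
  have -> : r *: (1 : R^o) = r by exact: mulr1.
  by congr (eta 1 _ 1); exact/esym/mul1r.
- apply: (bc_ind bcE) => // s r t.
  have -> : r = (r : R) *: (1 : R^o) by exact/esym/mulr1.
  by rewrite (bc_middlel bcE) (bc_pureE bcE).
- pose k s (r : R^o) t := b (s * phi r) t.
  have [|||||F FE] := bc_lift bcE (f := k).
  + by move=> *; rewrite /k mulrDl bl.
  + by move=> *; rewrite /k raddfD mulrDr bl.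
  + by move=> *; rewrite /k br.
  + by move=> s a p t; rewrite /k -mulrA -rmorphM.
  + by move=> s p a t; rewrite /k -bm -mulrA -rmorphM.
  exists F => s t.
  rewrite (bc_scale bcE) (bc_rscale bcE) mulr1 mul1r FE /k.
  by rewrite rmorph1 mulr1.
Qed.

End CentralGenerators.

Section RingDerivations.
Variable S : pzRingType.

Definition ring_derivation (E : bimodType S S) (D : S -> E) : Prop :=
  forall s t, D (s * t) = s *: D t + D s *< t.

Lemma ring_derivation_comp (E E' : bimodType S S) (h : {bimod E -> E'})
    (D : S -> E) : ring_derivation D -> ring_derivation (h \o D).
Proof. by move=> DM s t; rewrite /= DM raddfD /= linearZ /= rscalable. Qed.

Variable E : bimodType S S.
Implicit Types D : S -> E.

Lemma ring_derivationD D D' :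
  ring_derivation D -> ring_derivation D' -> ring_derivation (D \+ D').
Proof.
by move=> DM D'M s t; rewrite /= DM D'M scalerDr rscalerDl addrACA.
Qed.

Lemma ring_derivationB D D' :
  ring_derivation D -> ring_derivation D' -> ring_derivation (D \- D').
Proof.
by move=> DM D'M s t; rewrite /= DM D'M scalerBr rscaleBr opprD addrACA.
Qed.

Definition inner_derivation (e : E) (s : S) : E := e *< s - s *: e.

Fact inner_derivation_is_zmod_morphism e : zmod_morphism (inner_derivation e).
Proof.
by move=> s t; rewrite /inner_derivation rscalerB scalerBl !opprD addrACA.
Qed.

HB.instance Definition _ e := GRing.isZmodMorphism.Build S E
  (inner_derivation e) (inner_derivation_is_zmod_morphism e).

Lemma inner_derivationP e : ring_derivation (inner_derivation e).
Proof.
move=> s t; rewrite /inner_derivation scalerBr rscaleBr scaler_rscaler.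
by rewrite rscalerA scalerA [RHS]addrC addrA subrK.
Qed.

End RingDerivations.

Section PushoutSequence.
Variables (R0 R1 R2 S : pzRingType).
Variables (phi0 : {rmorphism R0 -> S}) (phi1 : {rmorphism R1 -> S})
  (phi2 : {rmorphism R2 -> S}).
Variables (E0 E1 E2 : bimodType S S) (e0 : E0) (e1 : E1) (e2 : E2).
Hypotheses (e0U : central_universal phi0 e0)
  (e1U : central_universal phi1 e1) (e2U : central_universal phi2 e2).

Hypothesis phi0_phi1 : forall w, exists x, phi0 w = phi1 x.
Hypothesis phi0_phi2 : forall w, exists x, phi0 w = phi2 x.
Hypothesis derivation_ext : forall (E : bimodType S S) (D : {additive S -> E}),
  ring_derivation D -> (forall x, D (phi1 x) = 0) ->
  (forall x, D (phi2 x) = 0) -> D =1 (fun _ => 0).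
Variables D1 D2 : {additive S -> E0}.
Hypotheses (D1M : ring_derivation D1) (D2M : ring_derivation D2)
  (D11 : forall x, D1 (phi1 x) = inner_derivation e0 (phi1 x))
  (D12 : forall x, D1 (phi2 x) = 0)
  (D21 : forall x, D2 (phi1 x) = 0)
  (D22 : forall x, D2 (phi2 x) = inner_derivation e0 (phi2 x)).


(** Both sides are derivations with the same values on the images of [R1] and [R2]. *)
Lemma derivation_split t : D1 t + D2 t = inner_derivation e0 t.
Proof.
apply/eqP; rewrite -subr_eq0; apply/eqP.
apply: (@derivation_ext _ ((D1 \+ D2) \- inner_derivation e0)) => [|x|y] /=.
- by apply: ring_derivationB (inner_derivationP e0); apply: ring_derivationD.
- by rewrite D11 D21 addr0 subrr.
- by rewrite D12 D22 add0r subrr.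
Qed.

Lemma derivation_vanish (E : bimodType S S) (h : {bimod E0 -> E})
    (D : {additive S -> E0}) : ring_derivation D ->
  (forall x, h (D (phi1 x)) = 0) -> (forall y, h (D (phi2 y)) = 0) ->
  forall t, h (D t) = 0.
Proof.
by move=> DM h1 h2 t; apply: (derivation_ext (D := h \o D));
  first exact: ring_derivation_comp.
Qed.

Lemma inner_derivation0 (R : pzRingType) (phi : {rmorphism R -> S})
    (E : bimodType S S) (e : E) (h : {bimod E0 -> E}) r :
  h e0 = e -> central_along phi e -> h (inner_derivation e0 (phi r)) = 0.
Proof.
move=> he eC; rewrite /inner_derivation raddfB /= linearZ /= rscalable he.
by rewrite eC subrr.
Qed.

(** Everything follows from [pq], [b1p] and [b2q]. For instance, if [b1] and [b2] both kill z, then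
    [pq] reads 0 = z, which is injectivity. The sign in [m2'] makes the second map the difference of
    the multiplications, so that the composite vanishes by [m12]. *)
Lemma pushout_sequence : exists (i : {bimod E0 -> (E1 * E2)%type})
    (p : {bimod (E1 * E2)%type -> S^o}),
  [/\ injective i, forall s, exists w, p w = s &
      forall w, p w = 0 <-> exists z, i z = w].
Proof.
have [b1 b1E] : exists h : {bimod E0 -> E1}, h e0 = e1.
  apply: (central_bimod e0U) => w; have [x ->] := phi0_phi1 w.
  exact: (cu_central e1U).
have [b2 b2E] : exists h : {bimod E0 -> E2}, h e0 = e2.
  apply: (central_bimod e0U) => w; have [x ->] := phi0_phi2 w.
  exact: (cu_central e2U).
have oneC (R : pzRingType) (phi : {rmorphism R -> S}) :
    central_along phi (1 : S^o).
  by move=> x; rewrite -[LHS]/(phi x * 1) -[RHS]/(1 * phi x) mulr1 mul1r.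
have [m1 m1E] := central_bimod e1U (oneC _ phi1).
have [m2 m2E] := central_bimod e2U (oneC _ phi2).
(* Balanced over [R2] because [D1] vanishes there: the Leibniz rule for [D1 (phi2 y * t)] leaves
   only [phi2 y *: D1 t]. *)
have [|||p pE] := cu_lift e2U (b := fun s t => s *: D1 t).
- by move=> *; rewrite scalerDl.
- by move=> *; rewrite raddfD scalerDr.
- by move=> s y t; rewrite D1M D12 rscale0r addr0 scalerA.
have [|||q qE] := cu_lift e1U (b := fun s t => s *: D2 t).
- by move=> *; rewrite scalerDl.
- by move=> *; rewrite raddfD scalerDr.
- by move=> s y t; rewrite D2M D21 rscale0r addr0 scalerA.
(* The derivation [b1 \o D1] vanishes on [R2] with [D1], and on [R1] because there it is inner for
   [e1], which [R1] centralises. *)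
have b1D t : b1 (D1 t) = 0.
  apply: derivation_vanish D1M _ _ t => x; last by rewrite D12 raddf0.
  by rewrite D11; exact: inner_derivation0 b1E (cu_central e1U).
have b2D t : b2 (D2 t) = 0.
  apply: derivation_vanish D2M _ _ t => x; first by rewrite D21 raddf0.
  by rewrite D22; exact: inner_derivation0 b2E (cu_central e2U).
have b1g s t : b1 (s *: e0 *< t) = s *: e1 *< t.
  by rewrite rscalable linearZ /= b1E.
have b2g s t : b2 (s *: e0 *< t) = s *: e2 *< t.
  by rewrite rscalable linearZ /= b2E.
have m1g s t : m1 (s *: e1 *< t) = s * t :> S.
  by rewrite rscalable linearZ /= m1E -[LHS]/(s * 1 * t) mulr1.
have m2g s t : m2 (s *: e2 *< t) = s * t :> S.
  by rewrite rscalable linearZ /= m2E -[LHS]/(s * 1 * t) mulr1.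
have pq z : p (b2 z) + q (b1 z) = z - (m1 (b1 z) : S) *: e0.
  elim/(cu_ind e0U): z => [|s t|u v Eu Ev].
  - by rewrite !raddf0 addr0 scale0r subr0.
  - rewrite b1g b2g pE qE m1g -scalerDr derivation_split /inner_derivation.
    by rewrite scalerBr scaler_rscaler scalerA.
  - by rewrite !raddfB /= scalerBl addrACA -opprD Eu Ev !opprD addrACA.
have m12 z : m1 (b1 z) = m2 (b2 z).
  elim/(cu_ind e0U): z => [|s t|u v Eu Ev]; first by rewrite !raddf0.
    by rewrite b1g b2g [LHS]m1g [RHS]m2g.
  by rewrite !raddfB /= Eu Ev.
have b1p z : b1 (p z) = 0.
  elim/(cu_ind e2U): z => [|s t|u v Eu Ev]; first by rewrite !raddf0.
    by rewrite pE linearZ /= b1D scaler0.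
  by rewrite !raddfB /= Eu Ev subr0.
have b2q z : b2 (q z) = 0.
  elim/(cu_ind e1U): z => [|s t|u v Eu Ev]; first by rewrite !raddf0.
    by rewrite qE linearZ /= b2D scaler0.
  by rewrite !raddfB /= Eu Ev subr0.
have b1_surj a : exists z, b1 z = a.
  elim/(cu_ind e1U): a => [|s t|_ _ [u <-] [v <-]].
  - by exists 0; rewrite raddf0.
  - by exists (s *: e0 *< t).
  - by exists (u - v); rewrite raddfB.
have b2_surj a : exists z, b2 z = a.
  elim/(cu_ind e2U): a => [|s t|_ _ [u <-] [v <-]].
  - by exists 0; rewrite raddf0.
  - by exists (s *: e0 *< t).
  - by exists (u - v); rewrite raddfB.
have [i iE] := bimod_pair b1 b2.
have [m2' m2'E] := bimod_opp m2; have [pi piE] := bimod_copair m1 m2'.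
exists i, pi; split=> [u v|s|[a b]].
- move=> uv; have : i (u - v) = 0 by rewrite raddfB /= uv subrr.
  rewrite iE => -[z1 z2].
  apply/eqP; rewrite -subr_eq0; have := pq (u - v).
  by rewrite z1 z2 !raddf0 addr0 scale0r subr0 => <-.
- exists ((s : S) *: e1, 0); rewrite piE /= raddf0 addr0 linearZ /= m1E.
  by rewrite -[LHS]/(s * 1) mulr1.
rewrite piE /= m2'E; split=> [/eqP|[z]]; last first.
  by rewrite iE => -[<- <-]; rewrite m12 subrr.
rewrite subr_eq0 => /eqP mab.
have [z za] := b1_surj a; have [z' zb] := b2_surj b.
have m0 : m1 (b1 (z - z')) = 0.
  by rewrite !raddfB /= [X in _ - X]m12 za zb mab subrr.
have := pq (z - z'); rewrite m0 scale0r subr0 => zz'.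
(* By [zz'] the difference of the two preimages is a [p] part, killed by [b1], plus a [q] part,
   killed by [b2]. Removing the [p] part from z keeps the value [a] under [b1] and changes the value
   under [b2] to that of z', which is [b]. *)
exists (z - p (b2 (z - z'))); rewrite iE; congr pair.
  by rewrite raddfB /= b1p subr0.
have pz : b2 (p (b2 (z - z'))) = b2 (z - z').
  by rewrite -[in RHS]zz' (raddfD b2 (p _)) /= b2q addr0.
by rewrite raddfB /= pz raddfB /= zb subKr.
Qed.

End PushoutSequence.

(** * Mapping cones *)

Section BimoduleImage.
Variables (R S : pzRingType) (U V : bimodType R S) (g : {bimod U -> V}).

Definition bimod_image : Type := image (g : {linear U -> V}).

HB.instance Definition _ := GRing.Lmodule.on bimod_image.

Fact bimod_image_rscale_subproof (w : bimod_image) (b : S) :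
  image_val w *< b \in image_pred (g : {linear U -> V}).
Proof.
case: w => v /asboolP[u gu] /=; apply/asboolP; exists (u *< b).
by rewrite -gu; exact: (rscalable g).
Qed.

Definition bimod_image_rscale (w : bimod_image) (b : S) : bimod_image :=
  Image (bimod_image_rscale_subproof w b).

Fact bimod_image_rscalerA w a b :
  bimod_image_rscale (bimod_image_rscale w a) b = bimod_image_rscale w (a * b).
Proof. by apply: val_inj; apply: rscalerA. Qed.

Fact bimod_image_rscaler1 w : bimod_image_rscale w 1 = w.
Proof. by apply: val_inj; apply: rscaler1. Qed.

Fact bimod_image_rscalerDl b : {morph bimod_image_rscale^~ b : u v / u + v}.
Proof. by move=> u v; apply: val_inj; apply: rscalerDl. Qed.

Fact bimod_image_rscalerDr w : {morph bimod_image_rscale w : a b / a + b}.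
Proof. by move=> a b; apply: val_inj; apply: rscalerDr. Qed.

Fact bimod_image_scaler_rscaler (a : R) w b :
  a *: bimod_image_rscale w b = bimod_image_rscale (a *: w) b.
Proof. by apply: val_inj; apply: scaler_rscaler. Qed.

HB.instance Definition _ := Lmodule_isBimodule.Build R S bimod_image
  bimod_image_rscalerA bimod_image_rscaler1 bimod_image_rscalerDl
  bimod_image_rscalerDr bimod_image_scaler_rscaler.

Lemma bimod_image_corestrict (P : bimodType R S) (f : {bimod P -> V}) :
  (forall x, exists u, g u = f x) ->
  exists h : {bimod P -> bimod_image}, forall x, image_val (h x) = f x.
Proof.
move=> fg.
have mem x : f x \in image_pred (g : {linear U -> V}) by apply/asboolP/fg.
pose h x : bimod_image := Image (mem x).
have hB : zmod_morphism h by move=> x y; apply: val_inj; exact: (raddfB f).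
have hZ : scalable h by move=> a x; apply: val_inj; exact: (linearZZ f).
have hr x b : h (x *< b) = h x *< b by apply: val_inj; exact: (rscalable f).
by exists (bimod_mor hB hZ hr).
Qed.

(** After both maps are corestricted to the image of [g], the map to lift along is surjective and
    projectivity applies. *)
Lemma projective_lift (P : bimodType R S) (f : {bimod P -> V}) :
  projective P -> (forall x, exists u, g u = f x) ->
  exists h : {bimod P -> U}, forall x, g (h x) = f x.
Proof.
move=> projP fg; have [f' f'E] := bimod_image_corestrict fg.
have [g' g'E] := bimod_image_corestrict (fun u => ex_intro _ u (erefl (g u))).
have [|h hE] := projP _ _ g' f'.
  by move=> [v Iv]; have /asboolP[u gu] := Iv; exists u;
     apply: val_inj; rewrite /= -gu; exact: g'E.
by exists h => x; rewrite -g'E hE f'E.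
Qed.

End BimoduleImage.

Section Cone.
Variables (R S : pzRingType) (A' B' V : bimodType R S).
Variables (iota : {bimod A' -> B'}) (pi : {bimod B' -> V}).
Hypotheses (iota_inj : injective iota)
  (pi_surj : forall v, exists b, pi b = v)
  (iota_pi : forall b, pi b = 0 <-> exists a, iota a = b).
Variables (A : projective_resolution A') (B : projective_resolution B').

(** The comparison theorem: a map between the resolved bimodules extends degree by degree to the
    resolutions. *)
Lemma chain_map_lift : exists f : forall k, {bimod A k -> B k},
  (forall x, res_aug B (f 0 x) = iota (res_aug A x)) /\
  (forall k x, res_diff B k (f k.+1 x) = f k (res_diff A k x)).
Proof.
(* This is the condition under which [f] can be lifted one degree further. The lift satisfies it
   again by exactness of [B], since two consecutive differentials of [A] compose to zero. *)
pose ok k (f : {bimod A k -> B k}) :=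
  forall x, exists y, res_diff B k y = f (res_diff A k x).
have ok_next k (s : {f | ok k f}) : exists s' : {f | ok k.+1 f},
    forall x, res_diff B k (sval s' x) = sval s (res_diff A k x).
  case: s => f okf /=; have [fd fdE] := bimod_comp f (res_diff A k).
  have [|f' f'E] := @projective_lift _ _ _ _ (res_diff B k) _ fd
    (@res_projective _ _ _ A k.+1).
    by move=> x; rewrite fdE.
  have okf' : ok k.+1 f'.
    move=> x; apply/res_exact; rewrite f'E fdE.
    by rewrite (_ : res_diff A k _ = 0) ?raddf0 //; apply/res_exact; exists x.
  by exists (exist _ f' okf') => x /=; rewrite f'E fdE.
have [ia iaE] := bimod_comp iota (res_aug A).
have [f0 f0E] := @res_projective _ _ _ A 0 _ _ (res_aug B) ia (res_aug_surj B).
have ok0 : ok 0 f0.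
  move=> x; apply/res_exact0; rewrite f0E iaE.
  by rewrite (_ : res_aug A _ = 0) ?raddf0 //; apply/res_exact0; exists x.
pose s := nat_rect (fun k => {f | ok k f}) (exist _ f0 ok0)
  (fun k s => sval (cid (ok_next k s))).
exists (fun k => sval (s k)); split=> [x|k x]; first by rewrite f0E iaE.
exact: (svalP (cid (ok_next k (s k)))).
Qed.

Variable f : forall k, {bimod A k -> B k}.
Hypotheses (f_aug : forall x, res_aug B (f 0 x) = iota (res_aug A x))
  (f_diff : forall k x, res_diff B k (f k.+1 x) = f k (res_diff A k x)).

(** The shifted summand [A] in degree -1 is zero, which leaves [B 0] alone in degree 0. *)
Definition cone_term (k : nat) : bimodType R S :=
  if k is k'.+1 then (A k' * B k)%type : bimodType R S else B 0.

(** The minus sign makes consecutive differentials compose to zero: the two terms that pass through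
    [f] cancel by [f_diff]. *)
Definition cone_diff (k : nat) : cone_term k.+1 -> cone_term k :=
  match k with
  | 0 => fun w : (A 0 * B 1)%type => f 0 w.1 + res_diff B 0 w.2
  | k'.+1 => fun w : (A k'.+1 * B k'.+2)%type =>
      (- res_diff A k' w.1, f k'.+1 w.1 + res_diff B k'.+1 w.2)
  end.

Lemma cone_diff_bimod k :
  exists d : {bimod cone_term k.+1 -> cone_term k}, d =1 cone_diff (k := k).
Proof.
case: k => [|k]; first exact: (bimod_copair (f 0) (res_diff B 0)).
have [h hE] := bimod_copair (f k.+1) (res_diff B k.+1).
have [f1 f1E] := bimod_opp (res_diff A k).
have cB : zmod_morphism (fun w : A k.+1 * B k.+2 => w.1) by [].
have cZ : scalable (fun w : A k.+1 * B k.+2 => w.1) by [].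
have cr (w : (A k.+1 * B k.+2)%type) (b : S) : (w *< b).1 = w.1 *< b by [].
have [g gE] := bimod_comp f1 (bimod_mor cB cZ cr).
have [d dE] := bimod_pair g h.
by exists d => w; rewrite dE gE f1E hE.
Qed.

Lemma diff_diff (C : bimodType R S) (P : projective_resolution C) k x :
  res_diff P k (res_diff P k.+1 x) = 0.
Proof. by apply/res_exact; exists x. Qed.

Lemma aug_diff (C : bimodType R S) (P : projective_resolution C) x :
  res_aug P (res_diff P 0 x) = 0.
Proof. by apply/res_exact0; exists x. Qed.

Lemma cone_exact0 (b : B 0) :
  pi (res_aug B b) = 0 <-> exists w, cone_diff (k := 0) w = b.
Proof.
split=> [/iota_pi[a']|[[a b1] <-]] /=.
  have [a <-] := res_aug_surj A a'; rewrite -f_aug => fab.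
  have /res_exact0[b1 b1E] : res_aug B (b - f 0 a) = 0.
    by rewrite raddfB /= fab subrr.
  by exists (a, b1); rewrite /= b1E addrC subrK.
apply/iota_pi; exists (res_aug A a).
by rewrite raddfD /= f_aug aug_diff addr0.
Qed.

(** Here the differential imposes no condition on the [A 0] component alone. Augmenting
    [f 0 a + d b = 0] gives that [iota] kills the augmentation of a, and injectivity of [iota] then
    makes a a boundary. *)
Lemma cone_exact1 (w : cone_term 1) :
  cone_diff w = 0 <-> exists w', cone_diff (k := 1) w' = w.
Proof.
case: w => a b /=; split=> [fab|[[a1 b2] [<- <-]]] /=; last first.
  rewrite raddfD /= f_diff diff_diff addr0 -raddfN /= -raddfD /= raddfN.
  by rewrite [X in f 0 X]addNr raddf0.
have /res_exact0[a1 a1E] : res_aug A a = 0.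
  apply: iota_inj; rewrite -f_aug raddf0.
  have := congr1 (res_aug B) fab; rewrite raddfD /= aug_diff addr0 => ->.
  by rewrite raddf0.
have /res_exact[b2 b2E] : res_diff B 0 (b + f 1 a1) = 0.
  by rewrite raddfD /= f_diff a1E addrC.
(* The sign of [a1] undoes the one in the cone differential; [b2] then corrects the second
   component. *)
exists (- a1, b2); rewrite /= [res_diff A _ _]raddfN [f _ _]raddfN /=.
by rewrite a1E opprK b2E addrC addrK.
Qed.

Lemma cone_exactS k (w : cone_term k.+2) :
  cone_diff w = 0 <-> exists w', cone_diff (k := k.+2) w' = w.
Proof.
case: w => a b /=; split=> [[a0 fab]|[[a1 b2] [<- <-]]] /=; last first.
  congr pair; first by rewrite [res_diff A k _]raddfN /= diff_diff !oppr0.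
  rewrite [res_diff B _ _]raddfD /= f_diff diff_diff addr0.
  by rewrite [f _ _]raddfN addNr.
have /res_exact[a1 a1E] : res_diff A k a = 0.
  by apply: oppr_inj; rewrite a0 oppr0.
have /res_exact[b2 b2E] : res_diff B k.+1 (b + f k.+2 a1) = 0.
  by rewrite raddfD /= f_diff a1E addrC.
exists (- a1, b2); rewrite /= [res_diff A _ _]raddfN [f _ _]raddfN /=.
by rewrite a1E opprK b2E addrC addrK.
Qed.

End Cone.

Lemma cone_resolution (R S : pzRingType) (A' B' V : bimodType R S)
    (iota : {bimod A' -> B'}) (pi : {bimod B' -> V})
    (A : projective_resolution A') (B : projective_resolution B') :
  injective iota -> (forall v, exists b, pi b = v) ->
  (forall b, pi b = 0 <-> exists a, iota a = b) ->
  exists C : projective_resolution V,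
    (finitely_generated (B 0) -> finitely_generated (C 0)) /\
    forall k, finitely_generated (A k) -> finitely_generated (B k.+1) ->
      finitely_generated (C k.+1).
Proof.
move=> iota_inj pi_surj iota_pi.
have [f [f_aug f_diff]] := chain_map_lift iota A B.
pose D k := cid (cone_diff_bimod f k); pose d k := sval (D k).
have dE k : d k =1 @cone_diff _ _ _ _ _ _ f k := svalP (D k).
have [e eE] := bimod_comp pi (res_aug B).
unshelve eexists.
  exists (cone_term A B) d e.
  - case=> [|k]; first exact: res_projective.
    by apply: projective_prod; exact: res_projective.
  - move=> v; have [b <-] := pi_surj v; have [x <-] := res_aug_surj B b.
    by exists x; rewrite eE.
  - move=> b; rewrite eE (cone_exact0 iota_pi f_aug).
    by split=> -[w wE]; exists w; rewrite ?dE // -dE.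
  - case=> [|k] w; rewrite dE.
      rewrite (cone_exact1 iota_inj f_aug f_diff).
      by split=> -[w' wE]; exists w'; rewrite ?dE // -dE.
    rewrite (cone_exactS f_diff).
    by split=> -[w' wE]; exists w'; rewrite ?dE // -dE.
by split=> //= k; exact: finitely_generated_prod.
Qed.

(** * Monoid rings of a pushout and conclusion *)

Lemma eq_on_generators (M : monoidType) (G : zmodType)
    (F F' : {additive monoid_ring M -> G}) :
  (forall x, F (mr_of x) = F' (mr_of x)) -> F =1 F'.
Proof.
move=> FF'; elim/mr_ind => [|//|r r' Er Er']; first by rewrite !raddf0.
by rewrite (raddfB F) (raddfB F') Er Er'.
Qed.

Section MonoidPushout.
Variables (M1 M2 W L : monoidType).
Variables (i1 : {monoid W -> M1}) (i2 : {monoid W -> M2})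
  (j1 : {monoid M1 -> L}) (j2 : {monoid M2 -> L}).
Hypothesis po : is_pushout i1 i2 j1 j2.
Local Notation S := (monoid_ring L).

Lemma monoid_ring_map_comp (M N P : monoidType) (f : {monoid M -> N})
    (g : {monoid N -> P}) r :
  monoid_ring_map (g \o f) r = monoid_ring_map g (monoid_ring_map f r).
Proof.
apply: (@eq_on_generators _ _ (monoid_ring_map (g \o f))
  (monoid_ring_map g \o monoid_ring_map f)) => x.
by rewrite /= !monoid_ring_mapU.
Qed.

Lemma ring_derivation_mr_of (E : bimodType S S) (D : S -> E) (M : monoidType)
    (j : {monoid M -> L}) :
  ring_derivation D -> derivation j (fun x => D (mr_of (j x))).
Proof. by move=> DM x y; rewrite gmulfM mr_ofM DM. Qed.

Lemma ring_derivation_ext (E : bimodType S S) (D : {additive S -> E}) :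
  ring_derivation D -> (forall r, D (monoid_ring_map j1 r) = 0) ->
  (forall r, D (monoid_ring_map j2 r) = 0) -> D =1 (fun _ => 0).
Proof.
move=> DM D1 D2; apply: (@eq_on_generators _ _ D \0) => z.
have dP := @ring_derivation_mr_of E D L idfun DM.
apply: (derivation_ext po dP (derivation0 E id)) => x /=.
  by have := D1 (mr_of x); rewrite monoid_ring_mapU.
by have := D2 (mr_of x); rewrite monoid_ring_mapU.
Qed.

Lemma pushout_ring_derivation (E : bimodType S S)
    (D1 D2 : {additive S -> E}) :
  ring_derivation D1 -> ring_derivation D2 ->
  (forall w, D1 (mr_of (j1 (i1 w))) = D2 (mr_of (j2 (i2 w)))) ->
  exists D : {additive S -> E}, [/\ ring_derivation D,
    forall r, D (monoid_ring_map j1 r) = D1 (monoid_ring_map j1 r) &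
    forall r, D (monoid_ring_map j2 r) = D2 (monoid_ring_map j2 r)].
Proof.
move=> D1M D2M D12.
have [d [dP d1 d2]] := pushout_derivation po
  (ring_derivation_mr_of j1 D1M) (ring_derivation_mr_of j2 D2M) D12.
have [D [DE DM]] := derivation_lift dP; exists D; split=> //.
  apply: (@eq_on_generators _ _ (D \o monoid_ring_map j1)
    (D1 \o monoid_ring_map j1)) => x.
  by rewrite /= monoid_ring_mapU DE d1.
apply: (@eq_on_generators _ _ (D \o monoid_ring_map j2)
  (D2 \o monoid_ring_map j2)) => x.
by rewrite /= monoid_ring_mapU DE d2.
Qed.

Lemma monoid_pushout_sequence (E0 E1 E2 : bimodType S S)
    (e0 : E0) (e1 : E1) (e2 : E2) :
  central_universal (monoid_ring_map (j1 \o i1)) e0 ->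
  central_universal (monoid_ring_map j1) e1 ->
  central_universal (monoid_ring_map j2) e2 ->
  exists (i : {bimod E0 -> (E1 * E2)%type}) (p : {bimod (E1 * E2)%type -> S^o}),
  [/\ injective i, forall s, exists w, p w = s &
      forall w, p w = 0 <-> exists z, i z = w].
Proof.
move=> e0U e1U e2U.
(* On [W] the inner derivation of [e0] agrees with zero, so the two can be glued along [W] in either
   order; this yields [D1] and [D2]. *)
have inner0 w : inner_derivation e0 (mr_of (j1 (i1 w))) = 0.
  have := cu_central e0U (mr_of w).
  rewrite /= monoid_ring_mapU /inner_derivation => ->.
  exact: subrr.
have zeroP : @ring_derivation S E0 \0.
  by move=> s t /=; rewrite scaler0 rscale0r addr0.
have innerP := @inner_derivationP S E0 e0.
have [|D1 [D1M D11 D12]] := pushout_ring_derivation innerP zeroP.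
  by move=> w; rewrite /= inner0.
have [|D2 [D2M D21 D22]] := pushout_ring_derivation zeroP innerP.
  by move=> w; rewrite /= -po.1 inner0.
apply: (pushout_sequence e0U e1U e2U _ _ ring_derivation_ext D1M D2M) => // w.
  by exists (monoid_ring_map i1 w); exact: monoid_ring_map_comp.
exists (monoid_ring_map i2 w); rewrite /= -monoid_ring_map_comp.
apply: (@eq_on_generators _ _ (monoid_ring_map (j1 \o i1))
  (monoid_ring_map (j2 \o i2))) => x.
by rewrite /= !monoid_ring_mapU /= po.1.
Qed.

End MonoidPushout.

Theorem theorem4p28 (M1 M2 W L : monoidType)
    (i1 : {monoid W -> M1}) (i2 : {monoid W -> M2})
    (j1 : {monoid M1 -> L}) (j2 : {monoid M2 -> L}) (n : enat) :
  injective i1 -> injective i2 ->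
  is_pushout i1 i2 j1 j2 ->
  flat_along j1 -> flat_along j2 -> flat_along (j1 \o i1) ->
  le_enat 1 n ->
  bi_FP n M1 -> bi_FP n M2 -> bi_FP (pred_enat n) W ->
  bi_FP n L.
Proof.
move=> _ _ po [fl1 fr1] [fl2 fr2] [fl0 fr0] n1 [P1 P1fg] [P2 P2fg] [P0 P0fg].
have [Q0 Q0fg] := base_change_resolution P0 fl0 fr0.
have [Q1 Q1fg] := base_change_resolution P1 fl1 fr1.
have [Q2 Q2fg] := base_change_resolution P2 fl2 fr2.
have [B Bfg] := prod_resolution Q1 Q2.
have [i [p [i_inj p_surj ip]]] := monoid_pushout_sequence po
  (base_change_central (base_change_is_base_change _ _))
  (base_change_central (base_change_is_base_change _ _))
  (base_change_central (base_change_is_base_change _ _)).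
have [C [C0fg Cfg]] := cone_resolution Q0 B i_inj p_surj ip.
have fgB k : le_enat k n -> finitely_generated (B k).
  by move=> kn; apply: Bfg; [apply/Q1fg/P1fg|apply/Q2fg/P2fg].
exists C => -[|k] kn; first by apply/C0fg/fgB.
apply: Cfg; last exact: fgB.
(* Degree k+1 of the cone uses [P0] in degree k, and k+1 <= n gives k <= n-1; [kn] rules out n = 0,
   and infinity is its own predecessor. *)
by apply/Q0fg/P0fg; case: (n) kn => [[|m]|].
Qed.
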